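(* Let $S$ be the antipode of the Hopf algebra $\mathbf{\Lambda}$ of symmetric functions in superspace and let $\omega:\mathbf{\Lambda}\to\mathbf{\Lambda}$ be the algebra homomorphism with $\omega(p_r)=(-1)^{r-1}p_r$ for $r\ge1$ and $\omega(\tilde p_\ell)=(-1)^\ell\tilde p_\ell$ for $\ell\ge0$. If $f\in\mathbf{\Lambda}$ is homogeneous of total degree $n$ and fermionic degree $m$, then $$S(f)=(-1)^{m+n}\,\omega(f).$$
   Context: Let $x_1,x_2,\dots$ be commuting variables and $\theta_1,\theta_2,\dots$ anticommuting variables ($\theta_i\theta_j=-\theta_j\theta_i$, $\theta_i^2=0$). $\mathbf{\Lambda}$ is the ring of formal power series over $\mathbb Q$ of bounded degree in these variables invariant under simultaneous permutation of the pairs $(x_i,\theta_i)$. Total degree means degree in the $x$'s; fermionic degree means degree in the $\theta$'s. The ring $\mathbf{\Lambda}$ is generated by $p_r=\sum_ix_i^r$ ($r\ge1$) and $\tilde p_k=\sum_i\theta_ix_i^k$ ($k\ge0$), freely up to the (anti)commutation relations. $\mathbf{\Lambda}\otimes\mathbf{\Lambda}$ is identified with functions of two sets of variables $(x;\theta)$, $(y;\phi)$, symmetric in each, with $\theta$'s and $\phi$'s anticommuting with each other; $f\otimes g$ corresponds to $f(x;\theta)g(y;\phi)$, so $(f_1\otimes g_1)(f_2\otimes g_2)=(-1)^{ab}f_1f_2\otimes g_1g_2$ if $g_1,f_2$ have fermionic degrees $a,b$. The coproduct is $(\Delta f)(x,y;\theta,\phi)=f(x,y;\theta,\phi)$, i.e.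 $f$ evaluated on the union of the two sets of variables; the counit $\epsilon$ is the identity on constants and zero on elements homogeneous of positive degree (total plus fermionic). With the multiplication map written $\mathrm{mult}$ and the unit map $u$, the antipode $S$ is the unique linear map with $\mathrm{mult}\circ(S\otimes1)\circ\Delta=u\circ\epsilon=\mathrm{mult}\circ(1\otimes S)\circ\Delta$. It satisfies $S(fg)=(-1)^{ab}S(g)S(f)$ for $f,g$ of fermionic degrees $a,b$. *)

(* Defs.v *)
From HB Require Import structures.
From mathcomp Require Import all_boot all_order all_algebra.
From mathcomp Require Import finmap multiset.
From mathcomp Require Import zify ring.
From mathcomp Require Import boolp classical_sets functions cardinality fsbigop.

Set Implicit Arguments.
Unset Strict Implicit.
Unset Printing Implicit Defensive.

Import Order.TTheory GRing.Theory Num.Theory.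
Local Open Scope mset_scope.
Local Open Scope fset_scope.
Local Open Scope ring_scope.

(* The pair (al, A) encodes the monomial x^al theta_A, where                 *)
(* theta_A = theta_{a_1} ... theta_{a_k} for A = {a_1 < ... < a_k}; the index *)
(* set I of the variables is ordered by choice.pickle (the usual order if I = nat). *)
Definition smonom (I : countType) : Type := ({mset I} * {fset I})%type.

Section Monomials.
Variable I : countType.
Implicit Types (u v w m : smonom I) (A B : {fset I}).

Definition smon1 : smonom I := (mset0, fset0).
Definition smul u v : smonom I := ((u.1 `+` v.1)%mset, u.2 `|` v.2).
Definition xdeg u : nat := size u.1.
Definition tdeg u : nat := #|` u.2|.

Definition inv A B : nat :=
  (\sum_(a <- A) \sum_(b <- B) (choice.pickle b < choice.pickle a))%N.

(* u * v = ssgn u v *: smul u v in the superalgebra. *)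
Definition ssgn u v : rat :=
  if [disjoint u.2 & v.2]%fset then (-1) ^+ inv u.2 v.2 else 0.

Lemma smulA : associative smul.
Proof. by move=> u v w; rewrite /smul /= msetDA fsetUA. Qed.
Lemma smulC : commutative smul.
Proof. by move=> u v; rewrite /smul /= msetDC fsetUC. Qed.
Lemma smul1m : left_id smon1 smul.
Proof. by case=> a A; rewrite /smul /= mset0D fset0U. Qed.
Lemma smulm1 : right_id smon1 smul.
Proof. by move=> u; rewrite smulC smul1m. Qed.

Lemma big_fsetUd (A B : {fset I}) (F : I -> nat) : [disjoint A & B]%fset ->
  (\sum_(a <- A `|` B) F a = \sum_(a <- A) F a + \sum_(a <- B) F a)%N.
Proof.
move=> dAB; rewrite -big_cat; apply: perm_big; apply: uniq_perm.
- exact: fset_uniq.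
- rewrite cat_uniq !fset_uniq /= andbT; apply/hasPn => x xB.
  by apply/negP => xA; move/fdisjointP: dAB => /(_ x xA); rewrite xB.
- by move=> x; rewrite mem_cat in_fsetU.
Qed.

Lemma ssgnA u v w :
  ssgn u v * ssgn (smul u v) w = ssgn v w * ssgn u (smul v w).
Proof.
rewrite /ssgn /= fdisjointUX fdisjointXU.
case: (boolP [disjoint u.2 & v.2]%fset) => duv; last by rewrite mul0r andFb mulr0.
case: (boolP [disjoint v.2 & w.2]%fset) => dvw; last by rewrite andbF mulr0 mul0r.
case: (boolP [disjoint u.2 & w.2]%fset) => duw; last by rewrite !mulr0.
rewrite -!exprD; congr (_ ^+ _); rewrite /inv big_fsetUd //.
rewrite [X in (_ + (_ + X))%N = _](_ : _ = inv v.2 w.2) //.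
rewrite [X in (_ = _ + X)%N](_ : _ = inv u.2 v.2 + inv u.2 w.2)%N.
  by rewrite /inv; lia.
by rewrite /inv -big_split /=; apply: eq_bigr => a _; rewrite big_fsetUd.
Qed.

Lemma ssgn1m u : ssgn smon1 u = 1.
Proof. by rewrite /ssgn fdisjoint0X /inv /= big_seq_fset0. Qed.
Lemma ssgnm1 u : ssgn u smon1 = 1.
Proof.
rewrite /ssgn fdisjointX0 /inv /= big1 // => a _.
by rewrite big_seq_fset0.
Qed.
End Monomials.

Section Divisors.
Variable I : countType.
Implicit Types (u v w m : smonom I).

Lemma smul_divisors m : exists2 D : seq (smonom I), uniq D &
  forall u v, smul u v = m -> u \in D /\ v \in D.
Proof.
pose E := [seq (seq_mset (mask (val b) (enum_mset m.1)), A) |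
            b <- enum {: (size m.1).-tuple bool}, A <- enum_fset (fpowerset m.2)].
suff HE u v : smul u v = m -> u \in E.
  exists (undup E); first exact: undup_uniq.
  by move=> u v uvm; rewrite !mem_undup (HE _ _ uvm) (HE v u) // smulC.
move=> uvm; have sub1 x : (count_mem x (enum_mset u.1) <= count_mem x (enum_mset m.1))%N.
  by rewrite !count_mem_mset -uvm msetE2 leq_addr.
have [s /subseqP [b sb ->] pus] := proj1 (count_subseqP _ _) sub1.
have sb' : size b == size m.1 by apply/eqP.
apply/allpairsP; exists (Tuple sb', u.2); split => /=.
- by rewrite mem_enum.
- by rewrite fpowersetE -uvm fsubsetUl.
- by rewrite [LHS]surjective_pairing; congr pair; rewrite -[LHS]seq_mset_id; apply/eq_seq_msetP.
Qed.

End Divisors.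

(* Formal power series over rat in the x_i, theta_i (i : I), given by their  *)
(* coefficients.                                                             *)
Record superseries (I : countType) :=
  SuperSeries { coef :> smonom I -> rat }.

HB.instance Definition _ I := gen_eqMixin (superseries I).
HB.instance Definition _ I := gen_choiceMixin (superseries I).

HB.lock Definition ssmul (I : countType) (f g : superseries I) : superseries I :=
  SuperSeries (fun m =>
    \sum_(uv \in [set uv : smonom I * smonom I | smul uv.1 uv.2 = m]%classic)
       ssgn uv.1 uv.2 * f uv.1 * g uv.2).

Section SuperSeries.
Variable I : countType.
Implicit Types (u v w m : smonom I) (f g h : superseries I) (c : rat).

Lemma superseriesP f g : f =1 g -> f = g.
Proof. by case: f g => [f] [g] /= /funext ->. Qed.

Definition ss0 := SuperSeries (fun _ : smonom I => 0).
Definition ssopp f := SuperSeries (fun m => - f m).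
Definition ssadd f g := SuperSeries (fun m => f m + g m).
Definition ssscale c f := SuperSeries (fun m => c * f m).
Definition ss1 := SuperSeries (fun m : smonom I => (m == smon1 I)%:R).
Local Notation ssmul := (@ssmul I).

Lemma ssaddA : associative ssadd.
Proof. by move=> f g h; apply: superseriesP => m /=; rewrite addrA. Qed.
Lemma ssaddC : commutative ssadd.
Proof. by move=> f g; apply: superseriesP => m /=; rewrite addrC. Qed.
Lemma ssadd0 : left_id ss0 ssadd.
Proof. by move=> f; apply: superseriesP => m /=; rewrite add0r. Qed.
Lemma ssaddN : left_inverse ss0 ssopp ssadd.
Proof. by move=> f; apply: superseriesP => m /=; rewrite addNr. Qed.

HB.instance Definition _ :=
  GRing.isZmodule.Build (superseries I) ssaddA ssaddC ssadd0 ssaddN.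

Lemma ssmulE (D : seq (smonom I)) f g m : uniq D ->
    (forall u v, smul u v = m -> u \in D /\ v \in D) ->
  ssmul f g m = \sum_(u <- D) \sum_(v <- D)
    (smul u v == m)%:R * (ssgn u v * f u * g v).
Proof.
move=> uD HD; rewrite unlock /= fsbig_mkcond (fsbigE (allpairs pair D D)) //=.
- rewrite (eq_bigl xpredT); last by move=> i; rewrite in_setT.
  rewrite big_allpairs_dep; apply: eq_bigr => u _; apply: eq_bigr => v _.
  rewrite /patch; case: eqP => [e|ne].
    by rewrite mem_set //= mul1r.
  by rewrite memNset ?mul0r.
- by apply: allpairs_uniq => // -[a b] [c d].
- move=> [u v] _ /=; rewrite /patch; case: ifP => // /set_mem /= e.
  have [uD' vD'] := HD _ _ e.
  by rewrite allpairs_f.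
Qed.

Lemma sum_delta (D : seq (smonom I)) (a : smonom I) (F : smonom I -> rat) : uniq D ->
  (a \notin D -> F a = 0) -> \sum_(u <- D) (a == u)%:R * F u = F a.
Proof.
move=> uD Fa; case: (boolP (a \in D)) => aD.
  rewrite (bigD1_seq a) //= eqxx mul1r big1 ?addr0 // => i /negPf.
  by rewrite eq_sym => ->; rewrite mul0r.
rewrite Fa // big_seq big1 // => i iD; case: eqP => [e|]; last by rewrite mul0r.
by rewrite e iD in aD.
Qed.

Lemma ssmulA : associative ssmul.
Proof.
move=> f g h; apply: superseriesP => m.
have [D uD HD] := smul_divisors m.
have HDl w t : smul w t = m -> forall u v, smul u v = w -> u \in D /\ v \in D.
  move=> wt u v uv; split.
    by have [] := HD u (smul v t) _; rewrite // smulA uv.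
  by have [] := HD v (smul u t) _; rewrite // smulA (smulC v) uv.
have HDr w t : smul w t = m -> forall u v, smul u v = t -> u \in D /\ v \in D.
  by rewrite smulC; apply: HDl.
pose T u v w := (smul u (smul v w) == m)%:R * (ssgn u v * ssgn (smul u v) w) * (f u * g v * h w).
transitivity (\sum_(u <- D) \sum_(v <- D) \sum_(w <- D) T u v w).
  rewrite (ssmulE f _ uD HD); apply: eq_bigr => u _.
  transitivity (\sum_(t <- D) \sum_(v <- D) \sum_(w <- D)
      (smul v w == t)%:R * ((smul u t == m)%:R * ssgn u t * ssgn v w * (f u * g v * h w))).
    apply: eq_bigr => t _; case: eqP => [e|_]; last first.
      rewrite mul0r big1 // => v _; rewrite big1 // => w _.
      by rewrite !(mul0r, mulr0).
    rewrite (ssmulE g h uD (HDr _ _ e)) mul1r !mulr_sumr.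
    apply: eq_bigr => v _; rewrite mulr_sumr; apply: eq_bigr => w _.
    rewrite mul1r; ring.
  rewrite exchange_big; apply: eq_bigr => v _.
  rewrite exchange_big; apply: eq_bigr => w _.
  rewrite sum_delta //.
    by rewrite /T ssgnA; ring.
  case: eqP => [e|]; last by rewrite !mul0r.
  by have [_ ->] := HD _ _ e.
rewrite (ssmulE _ _ uD HD); apply/esym.
transitivity (\sum_(t <- D) \sum_(w <- D) \sum_(u <- D) \sum_(v <- D)
      (smul u v == t)%:R * ((smul t w == m)%:R * ssgn t w * ssgn u v * (f u * g v * h w))).
  apply: eq_bigr => t _; apply: eq_bigr => w _; case: eqP => [e|_]; last first.
    rewrite mul0r big1 // => u _; rewrite big1 // => v _.
    by rewrite !(mul0r, mulr0).
  rewrite (ssmulE f g uD (HDl _ _ e)) mul1r mulr_sumr mulr_suml.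
  apply: eq_bigr => u _; rewrite mulr_sumr mulr_suml; apply: eq_bigr => v _.
  by rewrite mul1r; ring.
rewrite exchange_big /=.
under eq_bigr do rewrite exchange_big /=.
rewrite exchange_big; apply: eq_bigr => u _ /=.
under eq_bigr do rewrite exchange_big /=.
rewrite exchange_big; apply: eq_bigr => v _ /=.
apply: eq_bigr => w _; rewrite sum_delta //.
  by rewrite /T smulA; ring.
case: eqP => [e|]; last by rewrite !mul0r.
by have [-> _] := HD _ _ e.
Qed.

Lemma ssmul1 : left_id ss1 ssmul.
Proof.
move=> f; apply: superseriesP => m; have [D uD HD] := smul_divisors m.
rewrite (ssmulE _ _ uD HD) exchange_big /=.
transitivity (\sum_(v <- D) (m == v)%:R * f v); last first.
  apply: sum_delta => //; have [_ ->//] := HD (smon1 I) m (smul1m m).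
apply: eq_bigr => v _.
transitivity (\sum_(u <- D) (smon1 I == u)%:R * ((smul u v == m)%:R * (ssgn u v * f v))).
  by apply: eq_bigr => u _; rewrite /= [u == _]eq_sym; ring.
rewrite sum_delta // ?smul1m ?ssgn1m ?mul1r 1?eq_sym //.
by have [-> _] := HD (smon1 I) m (smul1m m).
Qed.

Lemma ssmulr1 : right_id ss1 ssmul.
Proof.
move=> f; apply: superseriesP => m; have [D uD HD] := smul_divisors m.
rewrite (ssmulE _ _ uD HD) /=.
transitivity (\sum_(v <- D) (m == v)%:R * f v); last first.
  apply: sum_delta => //; have [->//] := HD m (smon1 I) (smulm1 m).
apply: eq_bigr => v _.
transitivity (\sum_(u <- D) (smon1 I == u)%:R * ((smul v u == m)%:R * (ssgn v u * f v))).
  by apply: eq_bigr => u _; rewrite /= [u == _]eq_sym; ring.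
rewrite sum_delta // ?smulm1 ?ssgnm1 ?mul1r 1?eq_sym //.
by have [_ ->] := HD m (smon1 I) (smulm1 m).
Qed.

Lemma ssmulDl : left_distributive ssmul ssadd.
Proof.
move=> f g h; apply: superseriesP => m; have [D uD HD] := smul_divisors m.
rewrite (ssmulE _ _ uD HD) [RHS](_ : _ = coef (ssmul f h) m + coef (ssmul g h) m) //.
rewrite !(ssmulE _ _ uD HD) -big_split; apply: eq_bigr => u _ /=.
by rewrite -big_split; apply: eq_bigr => v _ /=; ring.
Qed.

Lemma ssmulDr : right_distributive ssmul ssadd.
Proof.
move=> f g h; apply: superseriesP => m; have [D uD HD] := smul_divisors m.
rewrite (ssmulE _ _ uD HD) [RHS](_ : _ = coef (ssmul f g) m + coef (ssmul f h) m) //.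
rewrite !(ssmulE _ _ uD HD) -big_split; apply: eq_bigr => u _ /=.
by rewrite -big_split; apply: eq_bigr => v _ /=; ring.
Qed.

Lemma ss1_neq0 : ss1 != 0 :> superseries I.
Proof. by apply/eqP => /(congr1 (fun f => coef f (smon1 I))) /=; rewrite eqxx. Qed.

HB.instance Definition _ := GRing.Zmodule_isNzRing.Build (superseries I)
  ssmulA ssmul1 ssmulr1 ssmulDl ssmulDr ss1_neq0.

Lemma ssscaleA a b f : ssscale a (ssscale b f) = ssscale (a * b) f.
Proof. by apply: superseriesP => m /=; rewrite mulrA. Qed.
Lemma ssscale1 : left_id 1 ssscale.
Proof. by move=> f; apply: superseriesP => m /=; rewrite mul1r. Qed.
Lemma ssscaleDr : right_distributive ssscale +%R.
Proof. by move=> c f g; apply: superseriesP => m /=; rewrite mulrDr. Qed.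
Lemma ssscaleDl f : {morph ssscale^~ f : a b / a + b}.
Proof. by move=> a b; apply: superseriesP => m /=; rewrite mulrDl. Qed.

HB.instance Definition _ := GRing.Zmodule_isLmodule.Build rat (superseries I)
  ssscaleA ssscale1 ssscaleDr ssscaleDl.

Lemma ssscaleAl c f g : c *: (f * g) = (c *: f) * g.
Proof.
apply: superseriesP => m; rewrite /GRing.mul /= unlock /= mulr_fsumr.
by apply: eq_fsbigr => uv _ /=; ring.
Qed.
Lemma ssscaleAr c f g : c *: (f * g) = f * (c *: g).
Proof.
apply: superseriesP => m; rewrite /GRing.mul /= unlock /= mulr_fsumr.
by apply: eq_fsbigr => uv _ /=; ring.
Qed.

HB.instance Definition _ :=
  GRing.Lmodule_isLalgebra.Build rat (superseries I) ssscaleAl.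
HB.instance Definition _ :=
  GRing.Lalgebra_isAlgebra.Build rat (superseries I) ssscaleAr.

End SuperSeries.

Section Renaming.
Variables (I J : countType) (e : I -> J).
Implicit Types (u v w : smonom I) (A B : {fset I}) (f g : superseries I).

(* x_i |-> x_{e i} and theta_i |-> theta_{e i} send the monomial u to        *)
(* rsgn u *: sren u.                                                         *)
Definition sren u : smonom J :=
  (seq_mset [seq e i | i <- enum_mset u.1], [fset e i | i in u.2]).

Definition rinv A B : nat := (\sum_(a <- A) \sum_(b <- B)
  ((choice.pickle a < choice.pickle b)
     && (choice.pickle (e b) < choice.pickle (e a))))%N.

Definition rsgn u : rat := (-1) ^+ rinv u.2 u.2.

End Renaming.

(* Substitution x_i |-> x_{e i}, theta_i |-> theta_{e i}, for injective e.   *)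
HB.lock Definition rename (I J : countType) (e : I -> J) (f : superseries I) :
    superseries J :=
  SuperSeries (fun m =>
    \sum_(u \in [set u : smonom I | sren e u = m]%classic) rsgn e u * f u).

Section RenamingLemmas.
Variables (I J : countType) (e : I -> J).
Implicit Types (u v w : smonom I) (A B : {fset I}) (f g : superseries I).
Local Notation sren := (sren e).
Local Notation rsgn := (rsgn e).
Local Notation rinv := (rinv e).
Local Notation rename := (rename e).

Lemma sren1 : sren (smon1 I) = smon1 J.
Proof.
rewrite /sren /= enum_mset0 /=; congr pair; last by rewrite imfset0.
by apply/msetP => x; rewrite mset_seqE mset0E.
Qed.

Lemma srenM u v : sren (smul u v) = smul (sren u) (sren v).
Proof.
rewrite /sren /smul /= imfsetU; congr pair.
apply/msetP => x; rewrite msetE2 !mset_seqE !count_map -count_cat.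
have p : perm_eq (enum_mset (u.1 `+` v.1)%mset) (enum_mset u.1 ++ enum_mset v.1).
  apply/eq_seq_msetP/msetP => y.
  by rewrite !mset_seqE count_cat !count_mem_mset msetE2.
exact: (permP p).
Qed.

Hypothesis e_inj : injective e.

Lemma sren_inj : injective sren.
Proof.
move=> [a A] [b B] /[dup] /(congr1 fst) /= /eq_seq_msetP eab.
move=> /(congr1 snd) /= /fsetP eAB; congr pair.
  rewrite -(seq_mset_id a) -(seq_mset_id b); apply/eq_seq_msetP.
  exact: perm_map_inj eab.
by apply/fsetP => x; have := eAB (e x); rewrite !mem_imfset /=.
Qed.

Lemma renameE f u : rename f (sren u) = rsgn u * f u.
Proof.
rewrite unlock /= (_ : [set u0 | _]%classic = [set u]%classic) ?fsbig_set1 //.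
by apply/seteqP; split => v /= => [/sren_inj|->].
Qed.

Lemma rename_notin f m : (forall u, sren u <> m) -> rename f m = 0.
Proof. by move=> nm; rewrite unlock; apply: fsbig1 => u /nm. Qed.

Lemma rename_neq0 f m : rename f m != 0 -> exists2 u, m = sren u & f u != 0.
Proof.
move=> fm; have [[u eum]|nm] := pselect (exists u, sren u = m).
  by exists u => //; move: fm; rewrite -eum renameE mulf_eq0 => /norP[].
by move: fm; rewrite rename_notin ?eqxx // => u um; apply: nm; exists u.
Qed.

Lemma xdeg_sren u : xdeg (sren u) = xdeg u.
Proof. by rewrite /xdeg /= (perm_size (perm_eq_seq_mset _)) size_map. Qed.

Lemma tdeg_sren u : tdeg (sren u) = tdeg u.
Proof. by rewrite /tdeg /= card_imfset. Qed.

Lemma rsgn_neq0 u : rsgn u != 0.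
Proof. by rewrite /rsgn signr_eq0. Qed.

Lemma rename1 : rename 1 = 1.
Proof.
apply: superseriesP => m.
have [[u <-]|nm] := pselect (exists u, sren u = m).
  rewrite renameE /= -sren1 (inj_eq sren_inj); case: eqP => [->|_].
    by rewrite /rsgn /rinv /= big_seq_fset0 mulr1.
  by rewrite mulr0.
rewrite rename_notin; last by move=> u um; apply: nm; exists u.
by rewrite /=; case: eqP => // m1; case: nm; exists (smon1 I); rewrite sren1.
Qed.

Lemma inv_imfset A B : inv [fset e i | i in A] [fset e i | i in B] =
  (\sum_(a <- A) \sum_(b <- B) (choice.pickle (e b) < choice.pickle (e a)))%N.
Proof.
rewrite /inv big_imfset /=; last by move=> ? ? _ _; apply: e_inj.
apply: eq_bigr => a _; rewrite big_imfset //=.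
by move=> ? ? _ _; apply: e_inj.
Qed.

Lemma disjoint_imfset A B :
  [disjoint [fset e i | i in A] & [fset e i | i in B]]%fset = [disjoint A & B]%fset.
Proof.
apply/fdisjointP/fdisjointP => H.
  by move=> a aA; have := H (e a); rewrite !mem_imfset //= => /(_ aA).
by move=> _ /imfsetP [a /= aA ->]; rewrite mem_imfset //=; apply: H.
Qed.

Lemma rsgnM u v :
  rsgn (smul u v) * ssgn u v = ssgn (sren u) (sren v) * (rsgn u * rsgn v).
Proof.
rewrite /ssgn /rsgn /= disjoint_imfset; case: ifP => dUV; last by rewrite mulr0 mul0r.
rewrite -!exprD inv_imfset; set A := u.2; set B := v.2.
have -> : rinv (A `|` B) (A `|` B) = (rinv A A + rinv A B + rinv B A + rinv B B)%N.
  rewrite {1}/rinv big_fsetUd //.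
  under eq_bigr do rewrite big_fsetUd //.
  under [X in (_ + X)%N]eq_bigr do rewrite big_fsetUd //.
  by rewrite !big_split /= /rinv !addnA.
have key : (rinv A B + rinv B A + inv A B =
    \sum_(a <- A) \sum_(b <- B) (choice.pickle (e b) < choice.pickle (e a)) + (rinv B A).*2)%N.
  rewrite -addnn [rinv B A]exchange_big /rinv /inv /=.
  rewrite -!big_split /=; apply: eq_big_seq => a aA.
  rewrite -!big_split /=; apply: eq_big_seq => b bB.
  have nab : a != b.
    apply/eqP => ab; move/fdisjointP: dUV => /(_ a aA).
    by rewrite ab -/B bB.
  have n1 : choice.pickle a != choice.pickle b by rewrite (inj_eq (pcan_inj choice.pickleK)).
  have n2 : choice.pickle (e a) != choice.pickle (e b).
    by rewrite (inj_eq (pcan_inj choice.pickleK)) (inj_eq e_inj).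
  case: (ltngtP (choice.pickle a) (choice.pickle b)) n1 => //= _ _;
  by case: (ltngtP (choice.pickle (e a)) (choice.pickle (e b))) n2.
have sgnP (k l : nat) : odd k = odd l -> (-1) ^+ k = (-1) ^+ l :> rat.
  by move=> kl; rewrite -signr_odd kl signr_odd.
have par (p q r s i y k : nat) : (q + r + i = y + k.*2)%N ->
  odd (p + q + r + s + i)%N = odd (y + (p + s))%N by lia.
exact: (sgnP _ _ (par _ _ _ _ _ _ _ key)).
Qed.

End RenamingLemmas.

Section RenamingTheory.
Implicit Types I J K : countType.

Lemma rename_linear I J (e : I -> J) : injective e -> linear (rename e).
Proof.
move=> e_inj c f g; apply: superseriesP => m.
have [[u <-]|nm] := pselect (exists u, sren e u = m).
  rewrite -[RHS]/(c * rename e f (sren e u) + rename e g (sren e u)).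
  by rewrite !renameE //=; ring.
have {}nm u : sren e u <> m by move=> um; apply: nm; exists u.
rewrite -[RHS]/(c * rename e f m + rename e g m) !rename_notin //.
by rewrite mulr0 addr0.
Qed.

Lemma sren_comp I J K (e1 : I -> J) (e2 : J -> K) u :
  sren (e2 \o e1) u = sren e2 (sren e1 u).
Proof.
rewrite /sren /=; congr pair.
  apply/eq_seq_msetP; rewrite map_comp perm_sym; apply: perm_map.
  exact: perm_eq_seq_mset.
apply/fsetP => x; apply/imfsetP/imfsetP => /= [[a aA ->]|[_ /imfsetP [a /= aA ->] ->]].
  by exists (e1 a) => //; apply/imfsetP; exists a.
by exists a.
Qed.

Lemma rsgn_comp I J K (e1 : I -> J) (e2 : J -> K) u :
  injective e1 -> injective e2 ->
  rsgn (e2 \o e1) u = rsgn e1 u * rsgn e2 (sren e1 u).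
Proof.
move=> inj1 inj2; rewrite /rsgn /= -exprD; set A := u.2.
have par (p q r k : nat) : (q + r = p + k.*2)%N ->
    (-1) ^+ p = (-1) ^+ (q + r)%N :> rat.
  by move=> ->; rewrite -signr_odd -[in RHS]signr_odd oddD odd_double addbF.
apply: (par _ _ _ (\sum_(a <- A) \sum_(b <- A)
  [&& choice.pickle a < choice.pickle b,
      choice.pickle (e1 b) < choice.pickle (e1 a)
    & choice.pickle (e2 (e1 a)) < choice.pickle (e2 (e1 b))])%N).
have -> : rinv e2 [fset e1 i | i in A] [fset e1 i | i in A] =
  (\sum_(a <- A) \sum_(b <- A)
   [&& choice.pickle a < choice.pickle b,
      choice.pickle (e1 a) < choice.pickle (e1 b)
    & choice.pickle (e2 (e1 b)) < choice.pickle (e2 (e1 a))] +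
   \sum_(a <- A) \sum_(b <- A)
   [&& choice.pickle a < choice.pickle b,
      choice.pickle (e1 b) < choice.pickle (e1 a)
    & choice.pickle (e2 (e1 a)) < choice.pickle (e2 (e1 b))])%N.
  rewrite [X in (_ + X)%N]exchange_big -big_split /= /rinv.
  rewrite big_imfset /=; last by move=> ? ? _ _; apply: inj1.
  apply: eq_bigr => a _; rewrite -big_split big_imfset /=; last first.
    by move=> ? ? _ _; apply: inj1.
  apply: eq_bigr => b _.
  case: (ltngtP (choice.pickle a) (choice.pickle b)) => //=; rewrite ?addn0 //.
  by move/(pcan_inj choice.pickleK) => ->; rewrite ltnn.
rewrite -addnn !addnA; congr addn.
rewrite /rinv -!big_split /=; apply: eq_bigr => a _.
rewrite -!big_split /=; apply: eq_bigr => b _.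
have [->|/eqP nab] := eqVneq a b; first by rewrite !ltnn.
have n1 : choice.pickle (e1 a) != choice.pickle (e1 b).
  by rewrite (inj_eq (pcan_inj choice.pickleK)) (inj_eq inj1); apply/eqP.
have n2 : choice.pickle (e2 (e1 a)) != choice.pickle (e2 (e1 b)).
  by rewrite (inj_eq (pcan_inj choice.pickleK)) (inj_eq inj2) (inj_eq inj1); apply/eqP.
case: (_ < _)%N => //=.
case: (ltngtP (choice.pickle (e1 a)) (choice.pickle (e1 b))) n1 => //= _ _;
by case: (ltngtP (choice.pickle (e2 (e1 a))) (choice.pickle (e2 (e1 b)))) n2.
Qed.

Lemma rename_comp I J K (e1 : I -> J) (e2 : J -> K) f :
  injective e1 -> injective e2 -> rename (e2 \o e1) f = rename e2 (rename e1 f).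
Proof.
move=> i1 i2; apply: superseriesP => m.
have i12 : injective (e2 \o e1) by apply: inj_comp.
have [[u <-]|nm] := pselect (exists u, sren (e2 \o e1) u = m).
  rewrite renameE // sren_comp renameE // renameE // rsgn_comp //; ring.
rewrite rename_notin; last by move=> u um; apply: nm; exists u.
apply/esym/eqP; apply: contrapT => /negP /(rename_neq0 i2) [v mv].
move=> /(rename_neq0 i1) [u vu _]; apply: nm; exists u.
by rewrite sren_comp -vu -mv.
Qed.

Lemma sren_bij I J (e : I -> J) : bijective e -> bijective (sren e).
Proof.
case=> e' eK e'K; have sid (L : countType) (h : L -> L) : h =1 id -> sren h =1 id.
  move=> hid [a A]; rewrite /sren /=; congr pair.
    by rewrite (eq_map hid) map_id seq_mset_id.
  apply/fsetP => x; apply/imfsetP/idP => /= [[y yA ->]|xA]; first by rewrite hid.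
  by exists x.
by exists (sren e') => u; rewrite -sren_comp sid.
Qed.

Lemma ssmul_neq0 I (f g : superseries I) m : (f * g) m != 0 ->
  exists u v, [/\ smul u v = m, ssgn u v != 0, f u != 0 & g v != 0].
Proof.
rewrite /GRing.mul /= unlock => /(@fsbigN1 _ _ _ unit _ _ (fun _ uv => _) tt) [[u v] /= uvm].
by rewrite !mulf_eq0 !negb_or => /andP[/andP[? ?] ?]; exists u, v.
Qed.

Lemma renameM I J (e : I -> J) f g : bijective e ->
  rename e (f * g) = rename e f * rename e g.
Proof.
move=> e_bij; have e_inj := bij_inj e_bij; apply: superseriesP => m.
have [s sK Ks] := sren_bij e_bij; rewrite -(Ks m); move: (s m) => {}m.
have [D uD HD] := smul_divisors m.
rewrite renameE // (ssmulE _ _ uD HD) (@ssmulE _ (map (sren e) D)); first last.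
- move=> u v; rewrite -(Ks u) -(Ks v) -srenM => /(sren_inj e_inj) /HD [? ?].
  by split; apply: map_f.
- by rewrite map_inj_uniq //; apply: sren_inj.
rewrite mulr_sumr big_map; apply: eq_bigr => u _.
rewrite mulr_sumr big_map; apply: eq_bigr => v _.
rewrite !renameE // -srenM (inj_eq (sren_inj e_inj)); case: eqP => [<-|_]; rewrite ?mul1r.
  transitivity (rsgn e (smul u v) * ssgn u v * (f u * g v)); first by ring.
  by rewrite rsgnM //; ring.
by rewrite !mul0r mulr0.
Qed.

End RenamingTheory.

HB.lock Definition smonomial (I : countType) (u : smonom I) : superseries I :=
  SuperSeries (fun m => (m == u)%:R).

Section Variables.
Variable I : countType.
Implicit Types (i j : I) (u v : smonom I).

Lemma smonomialE u m : smonomial u m = (m == u)%:R.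
Proof. by rewrite unlock. Qed.

Definition xvar i : superseries I := smonomial ([mset i]%mset, fset0).
Definition thvar i : superseries I := smonomial (mset0, [fset i]).

Lemma smonomialM u v :
  smonomial u * smonomial v = ssgn u v *: smonomial (smul u v).
Proof.
apply: superseriesP => m; have [D uD HD] := smul_divisors m.
rewrite (ssmulE _ _ uD HD) [RHS]/= smonomialE.
transitivity (\sum_(a <- D) (u == a)%:R * (\sum_(b <- D) (v == b)%:R *
     ((smul a b == m)%:R * ssgn a b : rat))).
  apply: eq_bigr => a _; rewrite mulr_sumr; apply: eq_bigr => b _.
  by rewrite !smonomialE [a == u]eq_sym [b == v]eq_sym; ring.
rewrite (sum_delta (F := fun a => \sum_(b <- D) _)) //.
  rewrite (sum_delta (F := fun b => (smul u b == m)%:R * ssgn u b)) //.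
    by rewrite mulrC eq_sym.
  by case: eqP => [e|]; [have [_ ->] := HD _ _ e | rewrite mul0r].
move=> uND; apply: big1 => b _; case: eqP => [e|]; last by rewrite mul0r.
case: eqP => [e'|]; last by rewrite mul0r mulr0.
by move: uND; have [-> _] := HD _ _ e'.
Qed.

Lemma xvarC i u : xvar i * smonomial u = smonomial u * xvar i.
Proof.
rewrite !smonomialM smulC /ssgn /= fdisjoint0X fdisjointX0 /inv.
rewrite big_seq_fset0 [in RHS]big1 // => a _; exact: big_seq_fset0.
Qed.

Lemma thvarC i j : thvar i * thvar j = - (thvar j * thvar i).
Proof.
rewrite !smonomialM -scaleNr [in RHS]smulC /ssgn /= !fdisjoint1X !inE eq_sym.
have [->|nij] := eqVneq i j; first by rewrite oppr0.
rewrite /inv !big_seq_fset1; congr (_ *: _).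
have : choice.pickle i != choice.pickle j.
  by rewrite (inj_eq (pcan_inj choice.pickleK)).
by case: ltngtP.
Qed.

Lemma thvar2 i : thvar i ^+ 2 = 0.
Proof.
by rewrite expr2 smonomialM /ssgn /= fdisjoint1X !inE eqxx scale0r.
Qed.

End Variables.

Section RenameVariables.
Variables (I J : countType) (e : I -> J).
Hypothesis e_inj : injective e.

Lemma rename_smonomial u :
  rename e (smonomial u) = rsgn e u *: smonomial (sren e u).
Proof.
apply: superseriesP => m.
have [[v <-]|nm] := pselect (exists v, sren e v = m).
  rewrite renameE //= !smonomialE.
  by rewrite (inj_eq (sren_inj e_inj)); case: eqP => [->|]; rewrite ?mulr0.
rewrite rename_notin /= ?smonomialE.
  by case: eqP => [mu|]; rewrite ?mulr0 //; case: nm; exists u.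
by move=> v vm; apply: nm; exists v.
Qed.

Lemma rename_xvar i : rename e (xvar i) = xvar (e i).
Proof.
rewrite rename_smonomial /rsgn /rinv /= big_seq_fset0 scale1r; congr smonomial.
rewrite /sren /= imfset0 enum_msetn /=; congr pair; apply/msetP => x.
by rewrite mset_seqE /= msetnE addn0 eq_sym; case: eqP.
Qed.

Lemma rename_thvar i : rename e (thvar i) = thvar (e i).
Proof.
rewrite rename_smonomial /rsgn /rinv /= !big_seq_fset1 ltnn scale1r; congr smonomial.
rewrite /sren /= imfset_fset1 enum_mset0 /=; congr pair; apply/msetP => x.
by rewrite mset_seqE mset0E.
Qed.

End RenameVariables.

(* Bounded degree and invariance under simultaneous permutations of the      *)
(* pairs (x_i, theta_i).                                                     *)
Definition bounded_degree I (f : superseries I) : Prop :=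
  exists d, forall u, f u != 0 -> (xdeg u + tdeg u <= d)%N.

Definition super_symmetric (f : superseries nat) : Prop :=
  forall s : nat -> nat, bijective s -> rename s f = f.

Definition super_sym_pred : {pred superseries nat} :=
  fun f => `[< super_symmetric f /\ bounded_degree f >].

Lemma degM I (f g : superseries I) d1 d2 :
  (forall u, f u != 0 -> (xdeg u + tdeg u <= d1)%N) ->
  (forall u, g u != 0 -> (xdeg u + tdeg u <= d2)%N) ->
  forall u, (f * g) u != 0 -> (xdeg u + tdeg u <= d1 + d2)%N.
Proof.
move=> fd gd m /ssmul_neq0 [u [v [<- _ /fd uf /gd vg]]].
have : (xdeg (smul u v) = xdeg u + xdeg v)%N.
  rewrite /xdeg /= -size_cat; apply: perm_size; apply/eq_seq_msetP/msetP => y.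
  by rewrite !mset_seqE count_cat !count_mem_mset msetE2.
have : (tdeg (smul u v) <= tdeg u + tdeg v)%N.
  by rewrite /tdeg /= cardfsU leq_subr.
lia.
Qed.

Fact super_sym_subalg : subalg_closed super_sym_pred.
Proof.
split.
- apply/asboolP; split=> [s sb|]; first exact: rename1 (bij_inj sb).
  exists 0 => u /=; case: (u =P _) => [-> _|_]; last by rewrite eqxx.
  by rewrite /xdeg /tdeg /= enum_mset0 cardfs0.
- move=> c f g /asboolP [fs [d1 fd]] /asboolP [gs [d2 gd]].
  apply/asboolP; split=> [s sb|].
    by rewrite rename_linear ?fs ?gs //; apply: bij_inj.
  exists (maxn d1 d2) => u; have [f0|/fd ? _] := eqVneq (f u) 0.
    by rewrite /= f0 mulr0 add0r => /gd; lia.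
  by lia.
- move=> f g /asboolP [fs [d1 fd]] /asboolP [gs [d2 gd]].
  apply/asboolP; split=> [s sb|]; first by rewrite renameM ?fs ?gs.
  by exists (d1 + d2)%N; apply: degM.
Qed.

HB.instance Definition _ := GRing.isSubalgClosed.Build rat (superseries nat)
  super_sym_pred super_sym_subalg.

(* The ring of symmetric functions in superspace.                            *)
Record superSym := SuperSym {
  super_sym_val :> superseries nat;
  _ : super_sym_val \in super_sym_pred }.

HB.instance Definition _ := [isSub for super_sym_val].
HB.instance Definition _ := [Choice of superSym by <:].
HB.instance Definition _ := [SubChoice_isSubAlgebra of superSym by <:].

Section PowerSums.

(* The formal sum \sum_i F i, taken coefficientwise.                         *)
Definition formal_sum (F : nat -> superseries nat) : superseries nat :=
  SuperSeries (fun m => \sum_(i \in [set: nat]%classic) F i m).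

Lemma formal_sum_sym F d :
    (forall s i, bijective s -> rename s (F i) = F (s i)) ->
    (forall i u, F i u != 0 -> (xdeg u + tdeg u <= d)%N) ->
  formal_sum F \in super_sym_pred.
Proof.
move=> sF dF; apply/asboolP; split=> [s sb|].
  have sinj := bij_inj sb.
  apply: superseriesP => m; have [t _ Kt] := sren_bij sb; rewrite -(Kt m).
  rewrite renameE //= [RHS](@reindex_fsbigT _ _ _ nat nat s) // mulr_fsumr.
  by apply: eq_fsbigr => i _; rewrite -(sF s i sb) renameE.
exists d => u /(@fsbigN1 _ _ _ unit _ _ (fun _ i => F i u) tt) [i _].
exact: dF.
Qed.

Lemma deg_xvarX (i r : nat) (u : smonom nat) : (xvar i ^+ r) u != 0 -> (xdeg u + tdeg u <= r)%N.
Proof.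
elim: r u => [|r IH] u.
  rewrite expr0 /=; case: (u =P _) => [-> _|_]; last by rewrite eqxx.
  by rewrite /xdeg /tdeg /= enum_mset0 cardfs0.
rewrite exprS -add1n; apply: degM IH _ => {}u; rewrite smonomialE; case: (u =P _) => [-> _|_]; last by rewrite eqxx.
by rewrite /xdeg /tdeg /= enum_msetn ?cardfs0.
Qed.

Lemma rename_xvarX (s : nat -> nat) (i r : nat) : bijective s ->
  rename s (xvar i ^+ r) = xvar (s i) ^+ r.
Proof.
move=> sb; have sinj := bij_inj sb; elim: r => [|r IH].
  rewrite !expr0; exact: rename1.
by rewrite !exprS renameM // IH rename_xvar.
Qed.

Fact powersum_subproof r :
  formal_sum (fun i => xvar i ^+ r) \in super_sym_pred.
Proof.
apply: (@formal_sum_sym _ r) => [s i sb|i u]; first exact: rename_xvarX.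
exact: deg_xvarX.
Qed.

Fact spowersum_subproof k :
  formal_sum (fun i => thvar i * xvar i ^+ k) \in super_sym_pred.
Proof.
apply: (@formal_sum_sym _ (1 + k)) => [s i sb|i].
  have sinj := bij_inj sb; by rewrite renameM // rename_xvarX // rename_thvar.
apply: degM => [u|]; last exact: deg_xvarX.
rewrite smonomialE; case: (u =P _) => [-> _|_]; last by rewrite eqxx.
by rewrite /xdeg /tdeg /= enum_mset0 ?cardfs1.
Qed.

(* p_r; meaningful for r >= 1 only. *)
Definition powersum r : superSym := SuperSym (powersum_subproof r).
(* \tilde p_k *)
Definition spowersum k : superSym := SuperSym (spowersum_subproof k).

End PowerSums.

(* Total degree n (in the x's) and fermionic degree m (in the theta's).       *)
Definition homogeneous (n m : nat) (f : superSym) : Prop :=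
  forall u, f u != 0 -> xdeg u = n /\ tdeg u = m.

Definition counit (f : superSym) : rat := f (smon1 nat).

Lemma counit_const (c : rat) : counit c%:A = c.
Proof. by rewrite /counit /= eqxx mulr1. Qed.

Lemma counit_linear (c : rat) (f g : superSym) :
  counit (c *: f + g) = c * counit f + counit g.
Proof. by []. Qed.

Lemma counit_homogeneous n m f :
  homogeneous n m f -> (0 < n + m)%N -> counit f = 0.
Proof.
move=> fnm nm; apply/eqP; apply: contraTT nm => /fnm [<- <-].
by rewrite /xdeg /tdeg /= enum_mset0 cardfs0.
Qed.

(* Functions of (x; theta), (y; phi) are series in variables indexed by      *)
(* nat + nat, the left summand for (x; theta), the right one for (y; phi).   *)
Notation superseries2 := (superseries (nat + nat)%type).

(* An enumeration of the union of the two sets of variables; by              *)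
(* coproduct_enum its choice is irrelevant.                                  *)
Definition union_enum (i : nat) : nat + nat :=
  if odd i then inr i./2 else inl i./2.

Definition coproduct (f : superSym) : superseries2 := rename union_enum f.

Lemma union_enum_bij : bijective union_enum.
Proof.
exists (fun j => match j with inl i => i.*2 | inr i => i.*2.+1 end) => [i|[i|i]].
- by rewrite /union_enum; case: ifP => io; rewrite -[RHS]odd_double_half io.
- by rewrite /union_enum odd_double doubleK.
- by rewrite /union_enum /= odd_double /= uphalf_double.
Qed.

Lemma coproduct_enum (e : nat -> nat + nat) (f : superSym) :
  bijective e -> rename e f = coproduct f.
Proof.
move=> eb; have [d dK Kd] := union_enum_bij.
have db : bijective d by exists union_enum.
have /asboolP [fs _] := valP f.
have sb : bijective (d \o e) by apply: bij_comp.
rewrite /coproduct -{2}(fs _ sb) -rename_comp; first last.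
- exact: bij_inj union_enum_bij.
- exact: bij_inj sb.
by congr rename; apply/funext => i /=; rewrite Kd.
Qed.

(* g \otimes h, identified with g(x; theta) h(y; phi). *)
Definition tens (g h : superSym) : superseries2 := rename (@inl nat nat) g * rename (@inr nat nat) h.

Section TensCoef.
Local Notation renl := (sren (@inl nat nat)).
Local Notation renr := (sren (@inr nat nat)).

Let linj : injective (@inl nat nat). Proof. by move=> ? ? []. Qed.
Let rinj : injective (@inr nat nat). Proof. by move=> ? ? []. Qed.

Lemma smul_lr_inj u v u1 v1 :
  smul (renl u1) (renr v1) = smul (renl u) (renr v) -> u1 = u /\ v1 = v.
Proof.
have cl (a : {mset nat} * {fset nat}) (b : {mset nat} * {fset nat}) x :
    (smul (renl a) (renr b)).1 (inl x) = a.1 x.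
  rewrite msetE2 !mset_seqE !count_map (@eq_count _ _ (pred1 x)) ?count_mem_mset; last first.
    by move=> y /=; rewrite (inj_eq linj).
  by rewrite [X in (_ + X)%N](@eq_count _ _ pred0) ?count_pred0 ?addn0.
have cr (a : {mset nat} * {fset nat}) (b : {mset nat} * {fset nat}) x :
    (smul (renl a) (renr b)).1 (inr x) = b.1 x.
  rewrite msetE2 !mset_seqE !count_map addnC (@eq_count _ _ (pred1 x)) ?count_mem_mset; last first.
    by move=> y /=; rewrite (inj_eq rinj).
  by rewrite [X in (_ + X)%N](@eq_count _ _ pred0) ?count_pred0 ?addn0.
have fl (a : {mset nat} * {fset nat}) (b : {mset nat} * {fset nat}) x :
    (inl x \in (smul (renl a) (renr b)).2) = (x \in a.2).
  rewrite in_fsetU mem_imfset //= orbC; case: imfsetP => //=.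
  by case=> y _.
have fr (a : {mset nat} * {fset nat}) (b : {mset nat} * {fset nat}) x :
    (inr x \in (smul (renl a) (renr b)).2) = (x \in b.2).
  rewrite in_fsetU mem_imfset //=; case: imfsetP => //=.
  by case=> y _.
move=> E; split; rewrite [LHS]surjective_pairing [RHS]surjective_pairing; congr pair.
- by apply/msetP => x; rewrite -(cl u1 v1) E cl.
- by apply/fsetP => x; rewrite -(fl u1 v1) E fl.
- by apply/msetP => x; rewrite -(cr u1 v1) E cr.
- by apply/fsetP => x; rewrite -(fr u1 v1) E fr.
Qed.

Lemma tens_coef g h u v :
  tens g h (smul (renl u) (renr v)) =
  ssgn (renl u) (renr v) * (rsgn (@inl nat nat) u * rsgn (@inr nat nat) v)
    * (g u * h v).
Proof.
set m := smul _ _; have [D uD HD] := smul_divisors m.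
have [uin vin] := HD _ _ (erefl m).
rewrite (ssmulE _ _ uD HD).
transitivity (\sum_(a <- D) (renl u == a)%:R * (\sum_(b <- D) (renr v == b)%:R *
   (ssgn a b * rename (@inl nat nat) g a * rename (@inr nat nat) h b))).
  apply: eq_bigr => a _; rewrite mulr_sumr; apply: eq_bigr => b _.
  have [<-|na] := eqVneq (renl u) a; have [<-|nb] := eqVneq (renr v) b.
  - by rewrite eqxx !mul1r.
  - rewrite mul0r mulr0; case: eqP => [E|_]; last by rewrite mul0r.
    have [->|/(rename_neq0 rinj) [v1 vb _]] := eqVneq (rename (@inr nat nat) h b) 0.
      by rewrite !mulr0.
    by move: E nb; rewrite vb => /smul_lr_inj [_ ->]; rewrite eqxx.
  - rewrite mul0r; case: eqP => [E|_]; last by rewrite mul0r.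
    have [->|/(rename_neq0 linj) [u1 ua _]] := eqVneq (rename (@inl nat nat) g a) 0.
      by rewrite !(mulr0, mul0r).
    by move: E na; rewrite ua => /smul_lr_inj [-> _]; rewrite eqxx.
  - rewrite mul0r; case: eqP => [E|_]; last by rewrite mul0r.
    have [->|/(rename_neq0 linj) [u1 ua _]] := eqVneq (rename (@inl nat nat) g a) 0.
      by rewrite !(mulr0, mul0r).
    have [->|/(rename_neq0 rinj) [v1 vb _]] := eqVneq (rename (@inr nat nat) h b) 0.
      by rewrite !mulr0.
    by move: E na; rewrite ua vb => /smul_lr_inj [-> _]; rewrite eqxx.
rewrite (sum_delta (F := fun a => \sum_(b <- D) _)) ?uin //.
rewrite (sum_delta (F := fun b => ssgn (renl u) b * rename (@inl nat nat) g (renl u)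
   * rename (@inr nat nat) h b)) ?vin //.
by rewrite !renameE //; ring.
Qed.

Lemma tens_sgn_neq0 u v :
  ssgn (renl u) (renr v) * (rsgn (@inl nat nat) u * rsgn (@inr nat nat) v) != 0.
Proof.
rewrite !mulf_neq0 ?rsgn_neq0 // /ssgn ifT ?signr_eq0 //.
apply/fdisjointP => _ /imfsetP [a /= _ ->]; apply/imfsetP => -[b _].
by [].
Qed.

End TensCoef.

Lemma tens_linearl h : linear (tens^~ h).
Proof.
move=> c g g'; rewrite /tens rename_linear ?mulrDl ?scalerAl //.
by move=> ? ? [].
Qed.

Lemma tens_linearr g : linear (tens g).
Proof.
move=> c h h'; rewrite /tens rename_linear ?mulrDr ?scalerAr //.
by move=> ? ? [].
Qed.

Definition tens_sum (s : seq (superSym * superSym)) : superseries2 :=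
  \sum_(gh <- s) tens gh.1 gh.2.

(* The linear map on the span of the g \otimes h determined by a bilinear b  *)
(* (see tens_liftE).                                                         *)
Definition tens_lift (V : lmodType rat) (b : superSym -> superSym -> V)
    (t : superseries2) : V :=
  \sum_(gh <- xget [::] [set s | tens_sum s = t]%classic) b gh.1 gh.2.

Section TensLift.
Variables (V : lmodType rat) (b : superSym -> superSym -> V).
Hypothesis bl : forall h, linear (b^~ h).
Hypothesis br : forall g, linear (b g).

Let bD g h h' c : b g (c *: h + h') = c *: b g h + b g h'.
Proof. exact: br. Qed.
Let bDl h g g' c : b (c *: g + g') h = c *: b g h + b g' h.
Proof. exact: bl. Qed.

Let b0 g : b g 0 = 0.
Proof. by have := bD g 0 0 (-1); rewrite scaler0 addr0 scaleN1r addNr. Qed.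
Let b0l h : b 0 h = 0.
Proof. by have := bDl h 0 0 (-1); rewrite scaler0 addr0 scaleN1r addNr. Qed.

Let bsuml (T : Type) (r : seq T) c (F : T -> superSym) h :
  b (\sum_(i <- r) c i *: F i) h = \sum_(i <- r) c i *: b (F i) h.
Proof. by elim: r => [|i r IH]; [rewrite !big_nil b0l | rewrite !big_cons bDl IH]. Qed.

Let tsuml (T : Type) (r : seq T) c (F : T -> superSym) h :
  tens (\sum_(i <- r) c i *: F i) h = \sum_(i <- r) c i *: tens (F i) h.
Proof.
elim: r => [|i r IH]; last by rewrite !big_cons tens_linearl IH.
rewrite !big_nil; have := tens_linearl h (-1) 0 0.
by rewrite scaler0 addr0 scaleN1r addNr.
Qed.

Lemma tens_sum_eq0 s : tens_sum s = 0 -> \sum_(gh <- s) b gh.1 gh.2 = 0.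
Proof.
have [n] := ubnP (size s); elim: n s => // n IH [|[g h] s] /=.
  by rewrite big_nil.
rewrite ltnS => ns; rewrite /tens_sum !big_cons /= => E.
have [h0|[v hv]] : h = 0 \/ exists v, h v != 0.
  have [ex|nex] := pselect (exists v, h v != 0); first by right.
  left; apply/val_inj/superseriesP => v /=.
  by apply/eqP; apply: contrapT => /negP hv; apply: nex; exists v.
  rewrite h0 b0 add0r; apply: IH => //; move: E; rewrite h0.
  have -> : tens g 0 = 0 by have := tens_linearr g (-1) 0 0; rewrite scaler0 addr0 scaleN1r addNr.
  by rewrite add0r.
pose c (gh : superSym * superSym) := - (gh.2 v / h v).
have gE : g = \sum_(gh <- s) c gh *: gh.1.
  apply/val_inj/superseriesP => u.
  have cu m : coef (\sum_(gh <- s) tens gh.1 gh.2) m =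
     \sum_(gh <- s) tens gh.1 gh.2 m.
    by elim: (s) => [|x r IHr]; [rewrite !big_nil | rewrite !big_cons /= IHr].
  have cs : val (\sum_(gh <- s) c gh *: gh.1) u = \sum_(gh <- s) c gh * gh.1 u.
    by elim: (s) => [|x r IHr]; [rewrite !big_nil | rewrite !big_cons /= IHr].
  rewrite cs; pose m := smul (sren (@inl nat nat) u) (sren (@inr nat nat) v).
  have : tens g h m + \sum_(gh <- s) tens gh.1 gh.2 m = 0.
    by rewrite -cu -[LHS]/(coef (tens g h + \sum_(gh <- s) tens gh.1 gh.2) m) E.
  rewrite tens_coef.
  under eq_bigr do rewrite tens_coef.
  rewrite -mulr_sumr -mulrDr => /eqP; rewrite mulf_eq0 (negPf (tens_sgn_neq0 _ _)) /=.
  rewrite addr_eq0 => /eqP gh.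
  apply: (mulIf hv); rewrite gh mulr_suml -sumrN; apply: eq_bigr => x _.
  by rewrite /c; field.
pose s' := [seq (gh.1, c gh *: h + gh.2) | gh <- s].
have tE : tens_sum s' = 0.
  rewrite /tens_sum big_map /= (eq_bigr _ (fun gh _ => tens_linearr gh.1 (c gh) h gh.2)).
  by rewrite big_split /= -tsuml -gE E.
have := IH s'; rewrite size_map => /(_ ns tE); rewrite big_map /=.
rewrite (eq_bigr _ (fun gh _ => bD gh.1 h gh.2 (c gh))).
by rewrite big_split /= -bsuml -gE.
Qed.

Lemma tens_liftE s : tens_lift b (tens_sum s) = \sum_(gh <- s) b gh.1 gh.2.
Proof.
rewrite /tens_lift; case: xgetP => [s' _ /= E|/(_ s) []//].
pose r := s' ++ [seq (- gh.1, gh.2) | gh <- s].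
have bN g h : b (- g) h = - b g h.
  by have := bDl h g 0 (-1); rewrite !scaleN1r b0l !addr0.
have tN g h : tens (- g) h = - tens g h.
  have := tens_linearl h (-1) g 0; rewrite !scaleN1r !addr0 => ->.
  have := tens_linearl h (-1) 0 0; rewrite scaler0 addr0 scaleN1r addNr => ->.
  by rewrite addr0.
have : \sum_(gh <- r) b gh.1 gh.2 = 0.
  apply: tens_sum_eq0; rewrite /tens_sum big_cat big_map /=.
  under [X in _ + X]eq_bigr do rewrite tN.
  by rewrite sumrN -/(tens_sum s') -/(tens_sum s) E subrr.
rewrite big_cat big_map /=.
under [X in _ + X]eq_bigr do rewrite bN.
by rewrite sumrN => /eqP; rewrite subr_eq0 => /eqP.
Qed.
End TensLift.

Definition tens_map (S T : superSym -> superSym) : superseries2 -> superseries2 :=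
  tens_lift (fun g h => tens (S g) (T h)).

Definition mult : superseries2 -> superSym := tens_lift (fun g h => g * h).

Lemma multE s : mult (tens_sum s) = \sum_(gh <- s) gh.1 * gh.2.
Proof.
apply: tens_liftE => [h c g g'|g c h h'].
  by rewrite mulrDl scalerAl.
by rewrite mulrDr scalerAr.
Qed.

Lemma tens_mapE (S T : {linear superSym -> superSym}) s :
  tens_map S T (tens_sum s) = \sum_(gh <- s) tens (S gh.1) (T gh.2).
Proof.
apply: tens_liftE => [h c g g'|g c h h'] /=; rewrite linearP.
  exact: tens_linearl.
exact: tens_linearr.
Qed.

Definition unit_map (c : rat) : superSym := c%:A.

Definition is_antipode (S : {linear superSym -> superSym}) : Prop :=
  mult \o tens_map S id \o coproduct =1 unit_map \o counit /\
  mult \o tens_map id S \o coproduct =1 unit_map \o counit.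

(* Main.v *)
Require Import Defs.
From HB Require Import structures.
From mathcomp Require Import all_boot all_order all_algebra.
From mathcomp Require Import finmap multiset zify ring.
From mathcomp Require Import boolp classical_sets fsbigop.
Import GRing.Theory Num.Theory.
Local Open Scope fset_scope.
Local Open Scope ring_scope.

Set Implicit Arguments.
Unset Strict Implicit.
Unset Printing Implicit Defensive.

(* Every power sum g is primitive, so the coproduct of a product w of k power   *)
(* sums is the signed sum of w_A (x) w_{A^c} over the subsets A of the factors. *)
(* By supercommutativity each signed product w_A w_{A^c} is w, so the identity  *)
(* mult (S (x) 1) Delta w = 0 and sum_A (-1)^|A| = 0 give S(w) = (-1)^k w by    *)
(* induction on k. As omega multiplies a power sum by (-1)^(total degree +      *)
(* fermionic degree + 1), this is the claim for w.                              *)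
(*                                                                              *)
(* It remains to see that a bihomogeneous f is a combination of such products   *)
(* of the same bidegree. An element of degree at most N is determined by its    *)
(* restriction to N variables. Averaging this restriction over the permutations *)
(* of the variables expresses it through sums of a monomial over all injective  *)
(* assignments of indices to its letters, and these are polynomials in the      *)
(* power sums by induction on the number of letters.                            *)

(** * Supercommutativity and renaming *)

Section Supercommutativity.
Variable I : countType.
Implicit Types (u v m : smonom I) (f g h : superseries I).

Lemma xdeg_smul u v : xdeg (smul u v) = (xdeg u + xdeg v)%N.
Proof.
rewrite /xdeg /= -size_cat; apply: perm_size; apply/eq_seq_msetP/msetP => y.
by rewrite !mset_seqE count_cat !count_mem_mset msetE2.
Qed.

Lemma tdeg_smul u v : ssgn u v != 0 -> tdeg (smul u v) = (tdeg u + tdeg v)%N.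
Proof.
rewrite /ssgn; case: ifP => [|_]; last by rewrite eqxx.
rewrite /fdisjoint /tdeg /= => /eqP uv _.
by rewrite cardfsU uv cardfs0 subn0.
Qed.

(** Two distinct indices [a] of [u] and [b] of [v] form an inversion in exactly one of the two
    orders. So the inversion numbers of (u, v) and (v, u) add up to [tdeg u * tdeg v]. *)
Lemma ssgnC u v : ssgn u v = (-1) ^+ (odd (tdeg u) && odd (tdeg v)) * ssgn v u.
Proof.
rewrite /ssgn fdisjoint_sym; case: ifP => d; last by rewrite mulr0.
have invC : (Defs.inv u.2 v.2 + Defs.inv v.2 u.2 = tdeg u * tdeg v)%N.
  rewrite /Defs.inv [X in (_ + X)%N]exchange_big /= -big_split /=.
  transitivity (\sum_(a <- u.2) \sum_(b <- v.2) 1)%N; last first.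
    by rewrite sum1_size big_const_seq count_predT iter_addn_0 mulnC.
  apply: eq_big_seq => a au; rewrite -big_split; apply: eq_big_seq => b bv /=.
  have : choice.pickle a != choice.pickle b.
    rewrite (inj_eq (pcan_inj choice.pickleK)); apply/eqP => ab.
    by move/fdisjointP: d => /(_ b bv); rewrite -ab au.
  by case: ltngtP.
rewrite -oddM -invC signr_odd -exprD -signr_odd -[in RHS]signr_odd.
by rewrite -addnA addnn oddD odd_double addbF.
Qed.

Definition fparity (b : bool) f := forall u, f u != 0 -> odd (tdeg u) = b.

Lemma fparityM b c f g : fparity b f -> fparity c g -> fparity (b (+) c) (f * g).
Proof.
move=> fb gc m /ssmul_neq0 [u [v [<- s /fb <- /gc <-]]].
by rewrite tdeg_smul // oddD.
Qed.

Lemma fparity1 : fparity false (1 : superseries I).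
Proof.
move=> u /=; case: (u =P _) => [-> _|_]; last by rewrite eqxx.
by rewrite /tdeg cardfs0.
Qed.

Lemma fparityC b c f g :
  fparity b f -> fparity c g -> f * g = (-1) ^+ (b && c) *: (g * f).
Proof.
move=> fb gc; apply: superseriesP => m; have [D uD HD] := smul_divisors m.
rewrite [RHS]/= !(ssmulE _ _ uD HD) exchange_big mulr_sumr; apply: eq_bigr => v _.
rewrite mulr_sumr; apply: eq_bigr => u _; rewrite smulC ssgnC.
have [->|/fb <-] := eqVneq (f u) 0; first by rewrite !(mulr0, mul0r).
have [->|/gc <-] := eqVneq (g v) 0; first by rewrite !(mulr0, mul0r).
by ring.
Qed.

End Supercommutativity.

Section RenameInjective.
Variables (I J : countType) (e : I -> J).
Hypothesis e_inj : injective e.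

Lemma seq_image (s : seq J) : (forall x, x \in s -> exists y, e y = x) ->
  exists l, s = map e l.
Proof.
elim: s => [|x s IH] H; first by exists [::].
have [l ->] := IH (fun y ys => H y (mem_behead (s := x :: s) ys)).
by have [y <-] := H x (mem_head _ _); exists (y :: l).
Qed.

(** The image of an injection need not contain every monomial over [J], but it is closed under
    taking divisors. This lets a coefficient of a product be computed on the divisors of [w]. *)
Lemma smul_sren a b w : smul a b = sren e w -> exists u, a = sren e u.
Proof.
move=> abw.
have [l El] : exists l, enum_mset a.1 = map e l.
  apply: seq_image => x xa.
  have : x \in (sren e w).1 by rewrite -abw /= in_msetD xa.
  rewrite /= (perm_mem (perm_eq_seq_mset _)) => /mapP [y _ ->].
  by exists y.
have [k Ek] : exists l, enum_fset a.2 = map e l.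
  apply: seq_image => x xa.
  have : x \in (sren e w).2 by rewrite -abw /= in_fsetU xa.
  by move=> /imfsetP [y _ ->]; exists y.
exists (seq_mset l, [fset i in k]); rewrite [LHS]surjective_pairing; congr pair => /=.
  rewrite -[LHS]seq_mset_id El; apply/eq_seq_msetP; apply: perm_map.
  by rewrite perm_sym perm_eq_seq_mset.
apply/fsetP => x; apply/idP/imfsetP => [|[y /=]].
  move=> /= xa; have : x \in map e k by rewrite -Ek.
  by move=> /mapP [y yk ->]; exists y; rewrite //= in_fset.
rewrite in_fset => yk ->.
have : e y \in map e k by apply: map_f.
by rewrite -Ek.
Qed.

(** [renameM] asks for a bijection, whereas the two inclusions [inl] and [inr] behind [tens] are
    only injective. *)
Lemma renameM_inj f g : rename e (f * g) = rename e f * rename e g.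
Proof.
apply: superseriesP => m.
have [[w <-]|nm] := pselect (exists w, sren e w = m); last first.
  rewrite rename_notin; last by move=> u um; apply: nm; exists u.
  apply/esym/eqP; apply: contrapT => /negP /ssmul_neq0 [a [b [abm _]]].
  move=> /(rename_neq0 e_inj) [u au _] /(rename_neq0 e_inj) [v bv _].
  by apply: nm; exists (smul u v); rewrite srenM -au -bv.
have [D uD HD] := smul_divisors w.
rewrite renameE // (ssmulE _ _ uD HD) (@ssmulE _ (map (sren e) D)); first last.
- move=> a b ab; have [u au] := smul_sren ab.
  have [v bv] : exists v, b = sren e v by apply: (@smul_sren b a w); rewrite smulC.
  move: ab; rewrite au bv -srenM => /(sren_inj e_inj) /HD [? ?].
  by split; apply: map_f.
- by rewrite map_inj_uniq //; apply: sren_inj.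
rewrite mulr_sumr big_map; apply: eq_bigr => u _.
rewrite mulr_sumr big_map; apply: eq_bigr => v _.
rewrite !renameE // -srenM (inj_eq (sren_inj e_inj)).
case: eqP => [<-|_]; last by rewrite !mul0r mulr0.
rewrite !mul1r.
transitivity (rsgn e (smul u v) * ssgn u v * (f u * g v)); first by ring.
by rewrite rsgnM //; ring.
Qed.

Lemma fparity_rename b f : fparity b f -> fparity b (rename e f).
Proof. by move=> fb m /(rename_neq0 e_inj) [u -> /fb]; rewrite tdeg_sren. Qed.

End RenameInjective.

(** * Power sums and their coproduct *)

(* The letter (a, e) stands for x^a theta^e. The trivial letter (0, false) is   *)
(* allowed, so that monomials in N variables are words of length exactly N.     *)
Notation gen := (nat * bool)%type.

Definition gmon (I : countType) (g : gen) (i : I) : smonom I :=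
  (msetn g.1 i, if g.2 then [fset i] else fset0).

Definition nontriv (g : gen) : bool := (0 < g.1)%N || g.2.

Section GeneratorMonomials.
Implicit Types (I J : countType) (g : gen).

Lemma tdeg_gmon I g (i : I) : tdeg (gmon g i) = g.2.
Proof. by rewrite /tdeg /gmon /=; case: g.2; rewrite ?cardfs1 ?cardfs0. Qed.

Lemma sren_gmon I J (e : I -> J) g i : sren e (gmon g i) = gmon g (e i).
Proof.
rewrite /sren /gmon /=; congr pair; last by case: g.2; rewrite ?imfset_fset1 ?imfset0.
apply/msetP => x; rewrite mset_seqE enum_msetn map_nseq count_nseq msetnE /=.
by rewrite eq_sym; case: eqP => _; rewrite ?mul1n ?mul0n.
Qed.

Lemma rsgn_gmon I J (e : I -> J) g i : rsgn e (gmon g i) = 1.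
Proof.
rewrite /rsgn /rinv /gmon /=; case: g.2; last by rewrite big_seq_fset0.
by rewrite !big_seq_fset1 ltnn.
Qed.

Lemma gmon_inj I g : nontriv g -> injective (@gmon I g).
Proof.
case: g => a [] /= ng i j /(congr1 (fun u : smonom I => (u.1 i, i \in u.2))) /= [].
  by rewrite !inE eqxx => _ /esym/eqP.
rewrite !msetnE eqxx; case: eqP => // _ a0.
by move: ng; rewrite /nontriv a0.
Qed.

Lemma gmon_xvar I a (i : I) : xvar i ^+ a = smonomial (gmon (a, false) i).
Proof.
elim: a => [|a IH].
  rewrite expr0; apply: superseriesP => u; rewrite smonomialE /=.
  congr (_ == _)%:R; rewrite /gmon /smon1 /=; congr pair.
  by apply/msetP => x; rewrite msetnE mset0E; case: eqP.
rewrite exprS IH /xvar smonomialM /ssgn /= fdisjoint0X /Defs.inv big_seq_fset0.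
rewrite scale1r; congr smonomial; rewrite /smul /gmon /= fsetUid; congr pair.
by apply/msetP => x; rewrite msetE2 !msetnE; case: eqP.
Qed.

Lemma gmon_thvar I a (i : I) : thvar i * xvar i ^+ a = smonomial (gmon (a, true) i).
Proof.
rewrite gmon_xvar /thvar smonomialM /ssgn /= fdisjointX0 /Defs.inv.
rewrite big_seq_fset1 big_seq_fset0 scale1r; congr smonomial.
by rewrite /smul /gmon /= fsetU0 mset0D.
Qed.

End GeneratorMonomials.

(* \tilde p_a for (a, true) and p_a for (a, false); the junk value            *)
(* psum (0, false) is excluded by [nontriv].                                    *)
Definition psum (g : gen) : superSym :=
  if g.2 then spowersum g.1 else powersum g.1.

Lemma psum_formal_sum g : super_sym_val (psum g) =
  formal_sum (fun i => smonomial (gmon g i)).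
Proof.
case: g => a []; rewrite /psum /=; congr formal_sum; apply/funext => i.
  exact: gmon_thvar.
exact: gmon_xvar.
Qed.

(** By [gmon_inj] at most one index contributes to a given coefficient, so the formal sum has finite
    support there. *)
Lemma psumE g u : nontriv g -> psum g u = `[< exists i, u = gmon g i >]%:R.
Proof.
move=> ng; rewrite psum_formal_sum /=.
case: asboolP => [[i ->]|nu]; last first.
  apply: fsbig1 => i _; rewrite smonomialE; case: eqP => // E.
  by case: nu; exists i.
rewrite (fsbigE [:: i]) //.
  rewrite big_cons big_nil in_setT smonomialE eqxx; exact: addr0.
move=> j _ /=; rewrite smonomialE inE; case: (gmon g i =P _) => // /(gmon_inj ng) ->.
by rewrite eqxx.
Qed.

Lemma rename_psum (J : countType) (e : nat -> J) g v : injective e -> nontriv g ->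
  rename e (psum g) v = `[< exists i, v = gmon g (e i) >]%:R.
Proof.
move=> e_inj ng; case: asboolP => [[i ->]|nv].
  rewrite -sren_gmon renameE // rsgn_gmon mul1r psumE //.
  by case: asboolP => // -[]; exists i.
apply/eqP; apply: contrapT => /negP /(rename_neq0 e_inj) [u vu].
rewrite psumE //; case: asboolP => [[i ui] _|_]; last by rewrite eqxx.
by case: nv; exists i; rewrite vu ui sren_gmon.
Qed.

Lemma fparity_psum g : fparity g.2 (psum g).
Proof.
move=> u; rewrite psum_formal_sum => /(@fsbigN1 _ _ _ unit _ _
  (fun _ i => smonomial (gmon g i) u) tt) [i _].
rewrite smonomialE; case: (u =P _) => [-> _|_]; last by rewrite eqxx.
by rewrite tdeg_gmon oddb.
Qed.

Lemma degree_psum g u : psum g u != 0 -> (xdeg u + tdeg u <= g.1 + g.2)%N.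
Proof.
rewrite psum_formal_sum => /(@fsbigN1 _ _ _ unit _ _
  (fun _ i => smonomial (gmon g i) u) tt) [i _].
rewrite smonomialE; case: (u =P _) => [-> _|_]; last by rewrite eqxx.
by rewrite tdeg_gmon /xdeg enum_msetn size_nseq.
Qed.

(** Primitivity of power sums: each index of the union belongs to exactly one of the two sets of
    variables. *)
Lemma coproduct_psum g : nontriv g ->
  coproduct (psum g) = rename (@inl nat nat) (psum g) + rename (@inr nat nat) (psum g).
Proof.
move=> ng; have [d dK Kd] := union_enum_bij.
have ueinj : injective union_enum by apply: can_inj dK.
apply: superseriesP => v; rewrite /coproduct rename_psum //.
rewrite [RHS](_ : _ = rename (@inl nat nat) (psum g) v + rename (@inr nat nat) (psum g) v) //.
rewrite (rename_psum _ inl_inj ng) (rename_psum _ inr_inj ng).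
case: (asboolP (exists i, v = gmon g (inl i))) => [[i ->]|nl].
  rewrite asboolT; last by exists (d (inl i)); rewrite Kd.
  by rewrite asboolF ?addr0 // => -[j] /(gmon_inj ng).
case: (asboolP (exists i, v = gmon g (inr i))) => [[i ->]|nr].
  by rewrite asboolT ?add0r //; exists (d (inr i)); rewrite Kd.
rewrite asboolF; first by rewrite addr0.
move=> -[j].
by case: (union_enum j) => i vi; [apply: nl | apply: nr]; exists i.
Qed.

(** * The antipode and omega on products of power sums *)

Definition pprod (w : seq gen) : superSym := \prod_(g <- w) psum g.

Definition xweight (w : seq gen) : nat := \sum_(g <- w) g.1.
Definition tweight (w : seq gen) : nat := \sum_(g <- w) g.2.

Lemma pprod_cons g w : pprod (g :: w) = psum g * pprod w.
Proof. exact: big_cons. Qed.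

Lemma xweight_cons g w : xweight (g :: w) = (g.1 + xweight w)%N.
Proof. exact: big_cons. Qed.

Lemma tweight_cons g w : tweight (g :: w) = (g.2 + tweight w)%N.
Proof. exact: big_cons. Qed.

Lemma fparity_pprod w : fparity (odd (tweight w)) (pprod w).
Proof.
elim: w => [|g w IH].
  by rewrite /pprod /tweight !big_nil; exact: fparity1.
rewrite pprod_cons tweight_cons oddD oddb.
exact: fparityM (fparity_psum (g := g)) IH.
Qed.

(* The terms (c, a, b) of the expansion of prod_i (g_i (x) 1 + 1 (x) g_i) as  *)
(* a sum of c *: (a (x) b).                                                   *)
Fixpoint psplit (w : seq gen) : seq (rat * seq gen * seq gen) :=
  if w is g :: w' then
    [seq (x.1.1, g :: x.1.2, x.2) | x <- psplit w'] ++
    [seq ((-1) ^+ (g.2 && odd (tweight x.1.2)) * x.1.1, x.1.2, g :: x.2) | x <- psplit w']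
  else [:: (1, [::], [::])].

(** The head is the term with all factors on the left, where [S] meets the whole word. In the other
    terms the left word is shorter ([psplit_size]), which makes the induction on the length
    possible. *)
Lemma psplit_head w : psplit w = (1, w, [::]) :: behead (psplit w).
Proof. by elim: w => //= g w ->. Qed.

(** Moving [g] back to the front costs the same sign that [psplit] recorded when [g] was put to the
    right, and the two signs cancel. *)
Lemma psplit_prod w x : x \in psplit w -> x.1.1 *: (pprod x.1.2 * pprod x.2) = pprod w.
Proof.
elim: w x => [|g w IH] x /=.
  by rewrite inE => /eqP -> /=; rewrite scale1r /pprod !big_nil mulr1.
rewrite mem_cat => /orP[] /mapP [y /IH {}IH ->] /=.
  by rewrite !pprod_cons -mulrA scalerAr IH.
rewrite !pprod_cons -IH mulrA; apply/val_inj => /=.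
have /= -> := fparityC (fparity_pprod (w := y.1.2)) (fparity_psum (g := g)).
rewrite andbC -!scalerAl -mulrA -scalerAr !scalerA; congr (_ *: _).
by rewrite mulrAC -expr2 sqrr_sign mul1r.
Qed.

Lemma psplit_size w x : x \in behead (psplit w) -> (size x.1.2 < size w)%N.
Proof.
have le_size v y : y \in psplit v -> (size y.1.2 <= size v)%N.
  elim: v y => [|g v IH] y /=; first by rewrite inE => /eqP ->.
  by rewrite mem_cat => /orP[] /mapP [z /IH zv ->] //=; apply: leqW.
elim: w x => [|g w IH] x //=.
rewrite psplit_head /= mem_cat => /orP[/mapP [y /IH yw ->]|] //.
rewrite inE => /orP[/eqP -> //|/mapP [y yw ->]] /=.
by rewrite ltnS le_size // psplit_head inE yw orbT.
Qed.

(** Terms that differ only in the side of [g] have opposite signs; this is the vanishing of the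
    alternating sum over subsets of a nonempty set. *)
Lemma psplit_signs g w : \sum_(x <- psplit (g :: w)) (-1) ^+ size x.1.2 = 0 :> rat.
Proof.
rewrite /= big_cat !big_map /=.
under eq_bigr do rewrite exprS mulN1r.
by rewrite sumrN addNr.
Qed.

Lemma coproduct_pprod w : all nontriv w ->
  coproduct (pprod w) = \sum_(x <- psplit w) x.1.1 *: tens (pprod x.1.2) (pprod x.2).
Proof.
have [d dK Kd] := union_enum_bij.
have ueinj : injective union_enum by apply: can_inj dK.
elim: w => [|g w IH] /= => [_|/andP[ng nw]].
  rewrite big_seq1 scale1r /tens /pprod !big_nil /coproduct.
  by rewrite (rename1 ueinj) (rename1 inl_inj) (rename1 inr_inj) mulr1.
rewrite pprod_cons /coproduct (renameM _ _ union_enum_bij) -/(coproduct _).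
rewrite -[rename _ (pprod w)]/(coproduct (pprod w)) IH // coproduct_psum //.
rewrite mulrDl big_cat !big_map /= !mulr_sumr; congr (_ + _); apply: eq_bigr => x _.
  rewrite -scalerAr; congr (_ *: _).
  by rewrite /tens pprod_cons mulrA -(renameM_inj inl_inj).
rewrite -scalerAr [RHS](_ : _ = x.1.1 *: ((-1) ^+ (g.2 && odd (tweight x.1.2)) *:
   tens (pprod x.1.2) (pprod (g :: x.2)))); last by rewrite scalerA; congr (_ *: _); rewrite mulrC.
congr (_ *: _); rewrite /tens pprod_cons (renameM_inj inr_inj) !mulrA.
(* The copy of [g] in the right variables has to pass the left factor, which produces the sign
   stored in [psplit]. *)
have fg := fparity_rename (@inr_inj nat nat) (fparity_psum (g := g)).
by rewrite (fparityC fg (fparity_rename inl_inj (fparity_pprod (w := x.1.2)))) -scalerAl.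
Qed.

(** Every monomial of the product is divisible by a nontrivial [gmon g i], hence is not constant. *)
Lemma counit_pprod g w : nontriv g -> counit (pprod (g :: w)) = 0.
Proof.
move=> ng; apply/eqP; apply: contrapT => /negP.
rewrite /counit pprod_cons => /ssmul_neq0 [u [v [uv _ + _]]].
rewrite psumE //; case: asboolP => [[i ui] _|_]; last by rewrite eqxx.
move: uv; rewrite ui /smul /smon1 => -[].
move=> /msetP /(_ i) + /fsetP /(_ i); rewrite msetE2 msetnE eqxx mset0E !inE.
move: ng; rewrite /nontriv; case: g.2 => /=; last by case: g.1.
by rewrite inE eqxx.
Qed.

Lemma antipode_coproduct (S : {linear superSym -> superSym}) w :
  is_antipode S -> all nontriv w ->
  \sum_(x <- psplit w) x.1.1 *: (S (pprod x.1.2) * pprod x.2) = (counit (pprod w))%:A.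
Proof.
move=> [SP _] nw; have := SP (pprod w); rewrite /unit_map /= => <-.
rewrite coproduct_pprod //.
(* A [tens_sum] has no scalars, so they are moved into the left factors. *)
pose s := [seq (x.1.1 *: pprod x.1.2, pprod x.2) | x <- psplit w].
have -> : \sum_(x <- psplit w) x.1.1 *: tens (pprod x.1.2) (pprod x.2) = tens_sum s.
  rewrite /tens_sum big_map; apply: eq_bigr => x _ /=.
  have := tens_linearl (pprod x.2) x.1.1 (pprod x.1.2) 0.
  have -> : tens 0 (pprod x.2) = 0.
    have := tens_linearl (pprod x.2) (-1) 0 0.
    by rewrite scaler0 addr0 scaleN1r addNr.
  by rewrite !addr0.
(* [idfun] supplies the linear structure that [tens_mapE] asks of the identity. *)
rewrite [tens_map _ _ _](@tens_mapE S idfun s).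
rewrite [\sum_(gh <- s) _](_ : _ = tens_sum [seq (S gh.1, gh.2) | gh <- s]).
  rewrite Defs.multE !big_map; apply: eq_bigr => x _ /=.
  by rewrite linearZ /= scalerAl.
by rewrite /tens_sum !big_map.
Qed.

Lemma antipode_pprod (S : {linear superSym -> superSym}) w :
  is_antipode S -> all nontriv w -> S (pprod w) = (-1) ^+ size w *: pprod w.
Proof.
move=> SP; have [n] := ubnP (size w); elim: n w => // n IH w wn nw.
have sub x : x \in psplit w -> all nontriv x.1.2.
  elim: (w) nw x => [|g v IHv] /= => [_ x|/andP[ng nv] x].
    by rewrite inE => /eqP ->.
  rewrite mem_cat => /orP[] /mapP [y /(IHv nv) yv ->] //=.
  by rewrite ng.
have := antipode_coproduct SP nw.
have {}IH x : x \in behead (psplit w) ->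
    x.1.1 *: (S (pprod x.1.2) * pprod x.2) = (-1) ^+ size x.1.2 *: pprod w.
  move=> xw; have xw' : x \in psplit w by rewrite psplit_head inE xw orbT.
  rewrite IH ?sub //; last by apply: leq_trans (psplit_size xw) _.
  by rewrite -scalerAl scalerA mulrC -scalerA (psplit_prod xw').
rewrite psplit_head big_cons /= scale1r {2}/pprod big_nil mulr1.
rewrite (eq_big_seq _ IH) -scaler_suml.
(* The empty word is treated apart: its only sign is 1, which does not cancel, and its counit is
   1. *)
case: w {wn sub IH} nw => [|g w] nw.
  by rewrite /= big_nil scale0r addr0 /pprod !big_nil /counit /= eqxx.
have ng : nontriv g by case/andP: nw.
rewrite counit_pprod // scale0r => /eqP; rewrite addr_eq0 => /eqP ->.
rewrite -scaleNr; congr (_ *: _); apply/eqP.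
(* The head contributes [(-1) ^+ size (g :: w)] to the vanishing sum, so the remaining signs add up
   to its negative. *)
have := psplit_signs g w; rewrite psplit_head big_cons /= => /eqP.
by rewrite addr_eq0 => /eqP ->.
Qed.

Lemma omega_pprod (omega : {lrmorphism superSym -> superSym}) w :
  (forall r : nat, (0 < r)%N ->
     omega (powersum r) = (-1) ^+ (r - 1)%N *: powersum r) ->
  (forall l : nat, omega (spowersum l) = (-1) ^+ l *: spowersum l) ->
  all nontriv w ->
  omega (pprod w) = (-1) ^+ (tweight w + xweight w + size w) *: pprod w.
Proof.
move=> op os; elim: w => [|g w IH] /= => [_|/andP[ng nw]].
  by rewrite /pprod /tweight /xweight !big_nil rmorph1 scale1r.
rewrite pprod_cons rmorphM /= IH // tweight_cons xweight_cons.
(* One exponent serves both kinds of letter: [a + 1] and [a - 1] have the same parity, and for a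
   fermionic letter [g.2 + 1] is 2. *)
have -> : omega (psum g) = (-1) ^+ (g.1 + g.2 + 1) *: psum g.
  case: g ng => a [] /=; rewrite /psum /nontriv /=.
    by rewrite os -addnA [in RHS]exprD sqrrN expr1n mulr1.
  by case: a => // a _; rewrite op // subn1 addn0 addn1 /= !exprS !mulN1r opprK.
rewrite -scalerAl -scalerAr scalerA -exprD; congr (_ ^+ _ *: _); lia.
Qed.

(** * Words and restriction to finitely many variables *)

Fixpoint wmon (w : seq gen) (t : seq nat) : smonom nat :=
  match w, t with
  | g :: w', i :: t' => smul (gmon g i) (wmon w' t')
  | _, _ => smon1 nat
  end.

(** The product keeps the order of the thetas, so it differs from the monomial [wmon w t] by a sign;
    in exchange it is renamed without any sign ([rename_wser]). *)
Fixpoint wser (w : seq gen) (t : seq nat) : superseries nat :=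
  match w, t with
  | g :: w', i :: t' => smonomial (gmon g i) * wser w' t'
  | _, _ => 1
  end.

Lemma smonomial1 : smonomial (smon1 nat) = 1.
Proof. by apply: superseriesP => u; rewrite smonomialE. Qed.

(** Writing the word as [map c t] names the letter placed at index [x]; [map_nth_index] brings any
    word of the right length to this form. *)
Lemma wmon_map (c : nat -> gen) t x : uniq t ->
  (wmon (map c t) t).1 x = (if x \in t then (c x).1 else 0%N) /\
  (x \in (wmon (map c t) t).2) = (x \in t) && (c x).2.
Proof.
elim: t => [|i t IH] /=; first by rewrite mset0E in_fset0.
case/andP=> it /IH [IH1 IH2]; rewrite msetE2 msetnE in_fsetU IH1 IH2 in_cons.
have [->|xi] /= := eqVneq x i.
  rewrite (negPf it) /= addn0; split=> //; rewrite orbF.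
  by case: (c i).2; rewrite ?in_fset1 ?eqxx ?in_fset0.
split=> //; case: (c i).2; rewrite ?in_fset1 ?(negPf xi) ?in_fset0 //.
Qed.

Lemma map_nth_index (w : seq gen) (t : seq nat) : uniq t -> size w = size t ->
  w = [seq nth (0%N, false) w (index i t) | i <- t].
Proof.
move=> ut wt; apply: (@eq_from_nth _ (0%N, false)); first by rewrite size_map.
move=> j; rewrite wt => jt.
by rewrite (nth_map 0%N) // index_uniq.
Qed.

Lemma wmonK w t : uniq t -> size w = size t ->
  [seq ((wmon w t).1 i, i \in (wmon w t).2) | i <- t] = w.
Proof.
move=> ut wt; rewrite [in RHS](map_nth_index ut wt); apply/eq_in_map => i it.
have := wmon_map (fun i => nth (0%N, false) w (index i t)) i ut.
rewrite -map_nth_index // it => -[-> ->] /=.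
by case: (nth _ _ _).
Qed.

(** With [wmonK], this matches words of length [size t] with monomials in the variables of [t], the
    trivial letter marking an absent variable. *)
Lemma wmon_coords (u : smonom nat) t : uniq t ->
  (forall i, i \in u.1 -> i \in t) -> (forall i, i \in u.2 -> i \in t) ->
  wmon [seq (u.1 i, i \in u.2) | i <- t] t = u.
Proof.
move=> ut u1 u2; rewrite [LHS]surjective_pairing [RHS]surjective_pairing; congr pair.
  apply/msetP => x; have [-> _] := wmon_map (fun i => (u.1 i, i \in u.2)) x ut.
  case: ifP => //= xt; apply/esym/eqP; rewrite mset_eq0 //.
  by apply: contraFN xt; apply: u1.
apply/fsetP => x; have [_ ->] := wmon_map (fun i => (u.1 i, i \in u.2)) x ut.
by rewrite /= andb_idl //; apply: u2.
Qed.

Lemma ssgn_gmon_wmon g i w t : i \notin t -> uniq t -> size w = size t ->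
  exists b : bool, ssgn (gmon g i) (wmon w t) = (-1) ^+ b.
Proof.
move=> it ut wt; rewrite /ssgn ifT.
  by exists (odd (Defs.inv (gmon g i).2 (wmon w t).2)); rewrite signr_odd.
apply/fdisjointP => j /=; case: g.2; rewrite ?in_fset0 // in_fset1 => /eqP ->.
rewrite (map_nth_index ut wt).
by have [_ ->] := wmon_map (fun i => nth (0%N, false) w (index i t)) i ut; rewrite (negPf it).
Qed.

Lemma wser_smonomial w t : uniq t -> size w = size t ->
  exists b : bool, wser w t = (-1) ^+ b *: smonomial (wmon w t).
Proof.
elim: w t => [|g w IH] [|i t] //=.
  by move=> _ _; exists false; rewrite expr0 scale1r smonomial1.
move=> /andP[it ut] [wt]; have [b ->] := IH t ut wt.
have [c sc] := ssgn_gmon_wmon g it ut wt.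
by exists (b (+) c); rewrite -scalerAr smonomialM sc scalerA signr_addb.
Qed.

Lemma xdeg_wmon w t : size w = size t -> xdeg (wmon w t) = xweight w.
Proof.
elim: w t => [|g w IH] [|i t] //=.
  by rewrite /xdeg enum_mset0 /xweight big_nil.
move=> [wt]; rewrite xdeg_smul IH // xweight_cons; congr (_ + _)%N.
by rewrite /xdeg enum_msetn size_nseq.
Qed.

Lemma tdeg_wmon w t : uniq t -> size w = size t -> tdeg (wmon w t) = tweight w.
Proof.
elim: w t => [|g w IH] [|i t] //=.
  by rewrite /tdeg cardfs0 /tweight big_nil.
move=> /andP[it ut] [wt]; have [c sc] := ssgn_gmon_wmon g it ut wt.
by rewrite tdeg_smul ?sc ?signr_eq0 // IH // tweight_cons tdeg_gmon.
Qed.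

Lemma rename_wser (s : nat -> nat) w t : injective s ->
  rename s (wser w t) = wser w (map s t).
Proof.
move=> s_inj; elim: w t => [|g w IH] [|i t] /=; rewrite ?rename1 //.
by rewrite renameM_inj // IH rename_smonomial // rsgn_gmon scale1r sren_gmon.
Qed.

Definition insupp (N : nat) (u : smonom nat) : bool :=
  all (fun i => i < N)%N (enum_mset u.1) && all (fun i => i < N)%N (enum_fset u.2).

Lemma insuppP N u :
  reflect ((forall i, i \in u.1 -> (i < N)%N) /\ (forall i, i \in u.2 -> (i < N)%N))
          (insupp N u).
Proof. by apply: (iffP andP) => -[/allP ? /allP ?]; split => //; apply/allP. Qed.

Lemma insupp_smul N u v : insupp N (smul u v) = insupp N u && insupp N v.
Proof.
apply/insuppP/andP => [[H1 H2]|[/insuppP [u1 u2] /insuppP [v1 v2]]].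
  by split; apply/insuppP; split => i iu;
    [apply: H1 | apply: H2 | apply: H1 | apply: H2];
    rewrite /= ?in_msetD ?in_fsetU iu ?orbT.
by split=> i /=; rewrite ?in_msetD ?in_fsetU => /orP[]; auto.
Qed.

(* Setting x_i = theta_i = 0 for i >= N. *)
Definition res (N : nat) (f : superseries nat) : superseries nat :=
  SuperSeries (fun u => if insupp N u then f u else 0).

Lemma res_linear N : linear (res N).
Proof.
move=> c f g; apply: superseriesP => u /=; case: ifP => //=.
by rewrite mulr0 addr0.
Qed.
HB.instance Definition _ N :=
  GRing.isLinear.Build rat (superseries nat) (superseries nat) _ (res N) (res_linear N).

(** A product of monomials lies in the first [N] variables exactly when both factors do. *)
Lemma resM N f g : res N (f * g) = res N f * res N g.
Proof.
apply: superseriesP => m; have [D uD HD] := smul_divisors m.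
rewrite /= !(ssmulE _ _ uD HD); case: ifP => mN.
  apply: eq_bigr => u _; apply: eq_bigr => v _ /=.
  case: eqP => [uvm|]; last by rewrite !mul0r.
  by move: mN; rewrite -uvm insupp_smul => /andP[-> ->].
apply/esym/big1 => u _; apply: big1 => v _ /=.
case: eqP => [uvm|]; last by rewrite !mul0r.
by move: mN; rewrite -uvm insupp_smul; case: ifP => _ /=; [move->|]; rewrite !(mulr0, mul0r).
Qed.

Lemma insupp_gmon N g i : nontriv g -> insupp N (gmon g i) = (i < N)%N.
Proof.
move=> ng; apply/insuppP/idP => [[H1 H2]|iN].
  case: g ng H1 H2 => a [] /= ng H1 H2; first by apply: H2; rewrite in_fset1.
  by apply: H1; rewrite in_msetn eqxx andbT; move: ng; rewrite /nontriv orbF.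
split=> j /=; first by rewrite in_msetn => /andP[_ /eqP ->].
by case: g.2; rewrite ?in_fset0 // in_fset1 => /eqP ->.
Qed.

Lemma superseries_sumE (T : Type) (r : seq T) (P : pred T) (F : T -> superseries nat) u :
  (\sum_(i <- r | P i) F i) u = \sum_(i <- r | P i) F i u.
Proof.
elim: r => [|i r IH]; first by rewrite !big_nil.
by rewrite !big_cons; case: ifP => _; rewrite -IH.
Qed.

Lemma res_psum N g : nontriv g ->
  res N (psum g) = \sum_(i <- iota 0 N) smonomial (gmon g i).
Proof.
move=> ng; apply: superseriesP => u; rewrite superseries_sumE /=.
under eq_bigr do rewrite smonomialE.
rewrite psumE //; case: asboolP => [[i ->]|nu]; last first.
  rewrite if_same big1 // => i _; case: eqP => // ui; case: nu; by exists i.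
rewrite insupp_gmon // (eq_bigr (fun j => (j == i)%:R)); last first.
  by move=> j _; rewrite (inj_eq (gmon_inj ng)) eq_sym.
have -> : (i < N)%N = (i \in iota 0 N) by rewrite mem_iota.
case: ifP => iN; last first.
  rewrite big_seq big1 // => j jN; case: eqP => // ji.
  by rewrite -ji jN in iN.
rewrite (bigD1_seq i) ?iota_uniq //= eqxx big1 ?addr0 // => j /negPf -> //.
Qed.

(** * Generation by power sums *)

Definition gmerge (g h : gen) : gen := ((g.1 + h.1)%N, g.2 || h.2).

Lemma fparity_gmon g (i : nat) : fparity g.2 (smonomial (gmon g i)).
Proof.
move=> u; rewrite smonomialE; case: (u =P _) => [-> _|_]; last by rewrite eqxx.
by rewrite tdeg_gmon oddb.
Qed.

(** The coefficient expresses that the square of a theta is 0; with at most one theta present no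
    sign can arise. *)
Lemma gmon_merge g h (i : nat) :
  smonomial (gmon g i) * smonomial (gmon h i) =
  (~~ (g.2 && h.2))%:R *: smonomial (gmon (gmerge g h) i).
Proof.
rewrite smonomialM; case: (boolP (g.2 && h.2)) => [/andP[g2 h2]|gh].
  by rewrite /ssgn /gmon /= g2 h2 fdisjoint1X in_fset1 eqxx !scale0r.
have -> : ssgn (gmon g i) (gmon h i) = 1.
  move: gh; rewrite /ssgn /gmon /Defs.inv /=; case: g.2; case: h.2 => //= _;
  by rewrite ?fdisjoint0X ?fdisjointX0 ?big_seq_fset1 ?big_seq_fset0 ?big_seq_fset0.
congr (_ *: smonomial _); rewrite /smul /gmon /=; congr pair.
  by apply/msetP => x; rewrite msetE2 !msetnE; case: eqP.
by move: gh; case: g.2; case: h.2; rewrite //= ?fsetU0 ?fset0U.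
Qed.

(** The terms in which [g] takes the index of a letter of [w] and fuses with it. The sign comes from
    moving [g] past the letters before that one. *)
Fixpoint absorb (g : gen) (w : seq gen) : seq (rat * seq gen) :=
  if w is h :: w' then
    ((~~ (g.2 && h.2))%:R, gmerge g h :: w') ::
    [seq ((-1) ^+ (g.2 && h.2) * x.1, h :: x.2) | x <- absorb g w']
  else [::].

Lemma absorbE g w t : size w = size t ->
  \sum_(i <- t) smonomial (gmon g i) * wser w t = \sum_(x <- absorb g w) x.1 *: wser x.2 t.
Proof.
elim: w t => [|h w IH] [|i t] //=; first by rewrite !big_nil.
move=> [wt]; rewrite !big_cons big_map /= mulrA gmon_merge scalerAl; congr (_ + _).
transitivity ((-1) ^+ (g.2 && h.2) *: (smonomial (gmon h i) *
   (\sum_(j <- t) smonomial (gmon g j) * wser w t))).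
  rewrite mulr_sumr scaler_sumr; apply: eq_bigr => j _.
  by rewrite !mulrA (fparityC (@fparity_gmon g j) (@fparity_gmon h i)) -!scalerAl.
rewrite IH // mulr_sumr scaler_sumr; apply: eq_bigr => x _.
by rewrite -scalerAr scalerA.
Qed.

(** When both letters carry a theta, [gmerge] keeps only one and the fermionic weight drops; the
    coefficient is then 0, whence the hypothesis on [x.1]. *)
Lemma absorb_weights g w x : x \in absorb g w -> x.1 != 0 ->
  [/\ size x.2 = size w, xweight x.2 = (g.1 + xweight w)%N
    & tweight x.2 = (g.2 + tweight w)%N].
Proof.
elim: w x => [|h w IH] x //=; rewrite inE => /orP[/eqP -> /=|/mapP [y yw ->]] /=.
  rewrite pnatr_eq0 eqb0 negbK !xweight_cons !tweight_cons addnA => gh.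
  by split=> //=; move: gh; case: g.2; case: h.2.
rewrite mulf_eq0 signr_eq0 /= => /(IH _ yw) [-> xE tE].
by rewrite !xweight_cons !tweight_cons xE tE; split=> //; lia.
Qed.

Fixpoint lists (T : Type) (k : nat) (L : seq T) : seq (seq T) :=
  if k is k'.+1 then [seq x :: t | x <- L, t <- lists k' L] else [:: [::]].

Lemma mem_lists (T : eqType) k (L : seq T) t :
  (t \in lists k L) = (size t == k) && all (mem L) t.
Proof.
elim: k t => [|k IH] [|x t] //=.
  by apply/allpairsP => -[[y z] [_ _]].
apply/allpairsP/andP => [[[y z] /= [yL zk [-> ->]]]|[tk /andP[xL tL]]].
  by move: zk; rewrite IH yL eqSS => /andP[-> ->].
by exists (x, t); rewrite IH /= xL -eqSS tk tL.
Qed.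

Lemma lists_uniq (T : eqType) k (L : seq T) : uniq L -> uniq (lists k L).
Proof.
move=> uL; elim: k => //= k IH; apply: allpairs_uniq => //.
by move=> [a b] [c d] _ _ /= [-> ->].
Qed.

(* A multiple of a monomial symmetric function in N variables. *)
Definition msum (N : nat) (w : seq gen) : superseries nat :=
  \sum_(t <- lists (size w) (iota 0 N) | uniq t) wser w t.

(* When a power sum is multiplied by [msum N w], the index of its summand is     *)
(* either new or one of those already used by a letter of w, which absorbs it.   *)
Lemma msum_cons N g w :
  (\sum_(i <- iota 0 N) smonomial (gmon g i)) * msum N w =
  msum N (g :: w) + \sum_(x <- absorb g w) x.1 *: msum N x.2.
Proof.
rewrite /msum /= [X in X + _]big_mkcond big_allpairs_dep /=.
have -> : \sum_(x <- absorb g w) x.1 *: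
    (\sum_(t <- lists (size x.2) (iota 0 N) | uniq t) wser x.2 t) =
  \sum_(t <- lists (size w) (iota 0 N) | uniq t)
    \sum_(i <- iota 0 N | i \in t) smonomial (gmon g i) * wser w t.
  transitivity (\sum_(x <- absorb g w)
     \sum_(t <- lists (size w) (iota 0 N) | uniq t) x.1 *: wser x.2 t).
    apply: eq_big_seq => x xw; rewrite scaler_sumr.
    have [->|x0] := eqVneq x.1 0.
      by rewrite !big1 // => t _; rewrite scale0r.
    by have [-> _ _] := absorb_weights xw x0.
  rewrite exchange_big big_seq_cond [RHS]big_seq_cond.
  apply: eq_bigr => t /andP[]; rewrite mem_lists => /andP[/eqP tw /allP tN] ut.
  rewrite -absorbE // -[RHS]big_filter; apply: perm_big; apply: uniq_perm => //.
    by rewrite filter_uniq ?iota_uniq.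
  move=> i; rewrite mem_filter andb_idr // => /tN; exact.
rewrite [X in X + _]exchange_big mulr_suml.
under [LHS]eq_bigr do rewrite mulr_sumr.
rewrite [LHS]exchange_big /= [LHS]big_mkcond [X in _ + X]big_mkcond -big_split /=.
apply: eq_bigr => t _; case: (uniq t); last first.
  by rewrite addr0 big1 // => i _; rewrite andbF.
rewrite [LHS](bigID (fun i => i \in t)) /= addrC; congr (_ + _).
by rewrite big_mkcond; apply: eq_bigr => i _; rewrite andbT.
Qed.

(** The span of the products of bidegree (n, m), given as an induction principle: a linear identity
    then reduces to each [pprod w]. *)
Inductive spanned (n m : nat) : superSym -> Prop :=
| spanned0 : spanned n m 0
| spannedD c w h : all nontriv w -> xweight w = n -> tweight w = m ->
    spanned n m h -> spanned n m (c *: pprod w + h).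

Definition res_spanned (N n m : nat) (q : superseries nat) : Prop :=
  exists2 h : superSym, spanned n m h & q = res N h.

Lemma res_spanned0 N n m : res_spanned N n m 0.
Proof. by exists 0; [exact: spanned0 | rewrite linear0]. Qed.

Lemma res_spannedD N n m q r :
  res_spanned N n m q -> res_spanned N n m r -> res_spanned N n m (q + r).
Proof.
move=> [h hs ->] [k ks ->]; exists (h + k); last by rewrite -linearD.
by elim: hs => [|c w l nw xw tw _ IH]; rewrite ?add0r // -addrA; apply: spannedD.
Qed.

Lemma res_spannedZ N n m c q : res_spanned N n m q -> res_spanned N n m (c *: q).
Proof.
move=> [h hs ->]; exists (c *: h); last by rewrite -linearZ.
elim: hs => [|d w l nw xw tw _ IH]; first by rewrite scaler0; exact: spanned0.
by rewrite scalerDr scalerA; apply: spannedD.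
Qed.

Lemma res_spanned_sum N n m (T : eqType) (r : seq T) (F : T -> superseries nat) :
  (forall x, x \in r -> res_spanned N n m (F x)) ->
  res_spanned N n m (\sum_(x <- r) F x).
Proof.
elim: r => [|x r IH] H; first by rewrite big_nil; exact: res_spanned0.
rewrite big_cons; apply: res_spannedD; first by apply: H; rewrite mem_head.
by apply: IH => y yr; apply: H; rewrite inE yr orbT.
Qed.

Lemma res_spannedM N n m (g : gen) q : res_spanned N n m q ->
  res_spanned N (g.1 + n) (g.2 + m)
    ((\sum_(i <- iota 0 N) smonomial (gmon g i)) * q).
Proof.
have [ng [h hs ->]|] := boolP (nontriv g).
  exists (psum g * h); last by rewrite -res_psum // -resM.
  elim: hs => [|c w l nw xw tw _ IH]; first by rewrite mulr0; exact: spanned0.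
  rewrite mulrDr -scalerAr -pprod_cons; apply: spannedD => //=; first by rewrite ng.
    by rewrite xweight_cons xw.
  by rewrite tweight_cons tw.
(* For the trivial letter each summand is 1, so the product is a sum of [N] copies of [q], without
   recourse to the junk value of [psum]. *)
case: g => [[|a] []] // _ qs.
rewrite mulr_suml; apply: res_spanned_sum => i _.
by rewrite -gmon_xvar expr0 mul1r.
Qed.

(** Solving [msum_cons] for [msum N (g :: w)] leaves only words of length [size w], to which
    induction applies. *)
Lemma msum_spanned N w : res_spanned N (xweight w) (tweight w) (msum N w).
Proof.
have [k] := ubnP (size w); elim: k w => // k IH [|g w] /= wk.
  rewrite /msum /= big_cons big_nil /= addr0 /xweight /tweight !big_nil.
  exists (1 *: pprod [::] + 0).
    by apply: spannedD; rewrite /xweight /tweight ?big_nil //; exact: spanned0.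
  rewrite addr0 scale1r /pprod big_nil; apply: superseriesP => u /=.
  case: ifP => // /negP; case: eqP => // -> [].
  by apply/insuppP; split=> i /=; rewrite ?in_fset0 // in_mset0.
rewrite -[msum _ _](addrK (\sum_(x <- absorb g w) x.1 *: msum N x.2)) -msum_cons.
rewrite xweight_cons tweight_cons; apply: res_spannedD.
  by apply: res_spannedM; apply: IH.
rewrite -scaleN1r; apply/res_spannedZ/res_spanned_sum => x xw.
have [->|x0] := eqVneq x.1 0; first by rewrite scale0r; exact: res_spanned0.
have [xs <- <-] := absorb_weights xw x0.
by apply/res_spannedZ/IH; rewrite xs.
Qed.

(** The default value [i] makes this the identity beyond the end of [t], so a permutation of 0, ...,
    N-1 extends to one of all indices. *)
Definition list_perm (t : seq nat) (i : nat) : nat := nth i t i.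

Lemma list_perm_bij N t : perm_eq t (iota 0 N) -> bijective (list_perm t).
Proof.
move=> p; have tN : size t = N by rewrite (perm_size p) size_iota.
have mt i : (i \in t) = (i < N)%N by rewrite (perm_mem p) mem_iota.
have ut : uniq t by rewrite (perm_uniq p) iota_uniq.
exists (fun i => if (i < N)%N then index i t else i) => i; rewrite /list_perm.
  have [iN|Ni] := ltnP i N; last by rewrite nth_default ?tN // ltnNge Ni.
  by rewrite -mt mem_nth ?tN // index_uniq // tN.
case: ifP => iN; first by rewrite nth_index // mt.
by rewrite nth_default // tN leqNgt iN.
Qed.

Lemma list_perm_lt N t i : perm_eq t (iota 0 N) -> (list_perm t i < N)%N = (i < N)%N.
Proof.
move=> p; have tN : size t = N by rewrite (perm_size p) size_iota.
have mt j : (j \in t) = (j < N)%N by rewrite (perm_mem p) mem_iota.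
have [iN|Ni] := ltnP i N; first by rewrite -mt mem_nth // tN.
by rewrite /list_perm nth_default ?tN // ltnNge Ni.
Qed.

Lemma map_list_perm N t : perm_eq t (iota 0 N) -> map (list_perm t) (iota 0 N) = t.
Proof.
move=> p; have tN : size t = N by rewrite (perm_size p) size_iota.
apply: (@eq_from_nth _ 0%N); first by rewrite size_map size_iota.
move=> i; rewrite size_map size_iota => iN.
rewrite (nth_map 0%N) ?size_iota // nth_iota // add0n.
by apply: set_nth_default; rewrite tN.
Qed.

Lemma insupp_sren N (s : nat -> nat) u :
  (forall i, (s i < N)%N = (i < N)%N) -> insupp N (sren s u) = insupp N u.
Proof.
move=> sN; apply/insuppP/insuppP => -[H1 H2]; split=> i /=.
- by move=> iu; rewrite -sN; apply: H1; rewrite /= (perm_mem (perm_eq_seq_mset _)) map_f.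
- by move=> iu; rewrite -sN; apply: H2; apply/imfsetP; exists i.
- by rewrite (perm_mem (perm_eq_seq_mset _)) => /mapP [j ju ->]; rewrite sN H1.
- by move=> /imfsetP [j /= ju ->]; rewrite sN H2.
Qed.

Lemma rename_res N t (f : superSym) : perm_eq t (iota 0 N) ->
  rename (list_perm t) (res N f) = res N f.
Proof.
move=> p; have sb := list_perm_bij p; have s_inj := bij_inj sb.
have /asboolP [fs _] := valP f.
apply: superseriesP => u; have [d dK Kd] := sren_bij sb; rewrite -(Kd u).
rewrite renameE //= insupp_sren => [|i]; last exact: list_perm_lt.
by case: ifP => _; rewrite ?mulr0 // -[in RHS](fs _ sb) renameE.
Qed.

(** The coefficient of [wser] at its own monomial is the sign between the two, and multiplying by it
    corrects the coefficient of [f]. Homogeneity bounds each exponent by [n], so finitely many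
    letters suffice. *)
Lemma res_expand N n m (f : superSym) : homogeneous n m f ->
  res N f = \sum_(w <- lists N [seq (a, e) | a <- iota 0 n.+1, e <- [:: false; true]])
    (f (wmon w (iota 0 N)) * wser w (iota 0 N) (wmon w (iota 0 N))) *: wser w (iota 0 N).
Proof.
move=> fh; set G := [seq _ | _ <- _, _ <- _].
have uG : uniq G by apply: allpairs_uniq; rewrite ?iota_uniq // => -[a b] [c d].
have uN := iota_uniq 0 N.
apply: superseriesP => u; rewrite superseries_sumE.
have termE w : w \in lists N G ->
    ((f (wmon w (iota 0 N)) * wser w (iota 0 N) (wmon w (iota 0 N))) *: wser w (iota 0 N)) u =
    f u * (u == wmon w (iota 0 N))%:R.
  rewrite mem_lists => /andP[/eqP wN _].
  have [b ->] := wser_smonomial uN (etrans wN (esym (size_iota 0 N))).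
  rewrite /= !smonomialE eqxx mulr1 -mulrA signrMK.
  by case: eqP => [->|_]; rewrite ?mulr0.
rewrite (eq_big_seq _ termE) /=.
have off w : w \in lists N G -> u = wmon w (iota 0 N) ->
    insupp N u /\ [seq (u.1 i, i \in u.2) | i <- iota 0 N] = w.
  rewrite mem_lists => /andP[/eqP wN _] ->.
  have wN' := etrans wN (esym (size_iota 0 N)); split; last exact: wmonK.
  apply/insuppP; rewrite (map_nth_index uN wN'); split=> i.
    have [iw _] := wmon_map (fun i => nth (0%N, false) w (index i (iota 0 N))) i uN.
    by apply: contraTT => iN; rewrite -mset_eq0 iw mem_iota (negPf iN).
  have [_ ->] := wmon_map (fun i => nth (0%N, false) w (index i (iota 0 N))) i uN.
  by rewrite mem_iota => /andP[].
have [f0|fu] := eqVneq (f u) 0.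
  by rewrite f0 if_same big1 // => w _; rewrite mul0r.
case: ifP => uS; last first.
  rewrite big_seq big1 // => w /off wu; case: eqP => [/wu []|_]; rewrite ?mulr0 //.
  by rewrite uS.
have /insuppP [u1 u2] := uS.
pose w0 := [seq (u.1 i, i \in u.2) | i <- iota 0 N].
have w0u : wmon w0 (iota 0 N) = u.
  by apply: wmon_coords => // i iu; rewrite mem_iota /= add0n; [apply: u1 | apply: u2].
have w0G : w0 \in lists N G.
  rewrite mem_lists size_map size_iota eqxx /=; apply/allP => _ /mapP [i _ ->].
  apply/allpairsP; exists (u.1 i, i \in u.2); split=> //; last by case: (i \in u.2).
  rewrite mem_iota add0n ltnS; have [<- _] := fh _ fu.
  by rewrite -count_mem_mset count_size.
rewrite (bigD1_seq w0) ?lists_uniq //= w0u eqxx mulr1 big_seq_cond big1 ?addr0 //.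
move=> w /andP[/off wu ww]; case: eqP => [/wu [_ E]|_]; last by rewrite mulr0.
by rewrite -E eqxx in ww.
Qed.

(* Averaging over the permutations of the N variables turns the expansion of  *)
(* res N f into monomials into an expansion into the msum N w.                *)
Lemma res_superSym_spanned N n m (f : superSym) :
  homogeneous n m f -> res_spanned N n m (res N f).
Proof.
move=> fh; set L := lists N (iota 0 N).
have uN := iota_uniq 0 N.
have LP t : t \in L -> uniq t -> perm_eq t (iota 0 N).
  rewrite mem_lists => /andP[/eqP tN /allP tL] ut; apply: uniq_perm => //.
  by apply: (uniq_min_size ut tL _).2; rewrite tN size_iota.
(* [K] is the number of permutations of the first [N] indices, by which the average is divided. *)
pose K : rat := \sum_(t <- L | uniq t) 1.
have K0 : K != 0.
  have iL : iota 0 N \in L.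
    by rewrite mem_lists size_iota eqxx; apply/allP.
  rewrite /K big_mkcond (bigD1_seq (iota 0 N)) ?lists_uniq //= uN.
  by rewrite lt0r_neq0 // ltr_wpDr // sumr_ge0 // => t _; case: ifP.
have -> : res N f = K^-1 *: \sum_(t <- L | uniq t) res N f.
  rewrite -[X in \sum_(_ <- _ | _) X]scale1r -scaler_suml scalerA mulVf //.
  by rewrite scale1r.
apply: res_spannedZ.
have -> : \sum_(t <- L | uniq t) res N f =
    \sum_(t <- L | uniq t) rename (list_perm t) (res N f).
  rewrite big_seq_cond [RHS]big_seq_cond; apply: eq_bigr => t /andP[tL ut].
  by rewrite (@rename_res N) // LP.
rewrite (res_expand N fh); set G := [seq _ | _ <- _, _ <- _].
set c := fun w => f (wmon w (iota 0 N)) * wser w (iota 0 N) (wmon w (iota 0 N)).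
have -> : \sum_(t <- L | uniq t)
      rename (list_perm t) (\sum_(w <- lists N G) c w *: wser w (iota 0 N)) =
    \sum_(w <- lists N G) c w *: msum N w.
  transitivity (\sum_(t <- L | uniq t) \sum_(w <- lists N G) c w *: wser w t).
    rewrite big_seq_cond [RHS]big_seq_cond; apply: eq_bigr => t /andP[tL ut].
    have tp := LP t tL ut; have s_inj := bij_inj (list_perm_bij tp).
    elim: (lists N G) => [|w r IH].
      have := rename_linear s_inj (-1) 0 0.
      by rewrite !big_nil scaler0 addr0 scaleN1r addNr.
    by rewrite !big_cons rename_linear // IH rename_wser // (map_list_perm tp).
  rewrite exchange_big; apply: eq_big_seq => w.
  rewrite mem_lists => /andP[/eqP wN _].
  by rewrite -scaler_sumr /msum wN.
apply: res_spanned_sum => w; rewrite mem_lists => /andP[/eqP wN _].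
have wN' := etrans wN (esym (size_iota 0 N)).
(* A nonzero coefficient puts [wmon w (iota 0 N)] in the support of [f], which forces the weights of
   [w] to be [n] and [m]. *)
have [c0|] := eqVneq (c w) 0; first by rewrite c0 scale0r; exact: res_spanned0.
rewrite mulf_eq0 => /norP[/fh [wx wt] _].
rewrite (xdeg_wmon wN') in wx; rewrite (tdeg_wmon uN wN') in wt.
by rewrite -wx -wt; apply/res_spannedZ/msum_spanned.
Qed.

(** A monomial of degree at most [N] involves at most [N] variables. A permutation moves them into
    the first [N], and by symmetry this changes the coefficient only by a sign. *)
Lemma res_eq0 N (f : superSym) :
  (forall u, f u != 0 -> (xdeg u + tdeg u <= N)%N) -> res N f = 0 -> f = 0.
Proof.
move=> fN rf; apply/val_inj/superseriesP => u /=.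
apply/eqP; apply: contrapT => /negP fu.
have /asboolP [fs _] := valP f.
pose l := undup (enum_mset u.1 ++ enum_fset u.2).
have lN : (size l <= N)%N.
  by apply: leq_trans (size_undup _) _; rewrite size_cat; exact: fN fu.
pose B := (\max_(i <- l) i).+1.
have lB i : i \in l -> (i < B)%N.
  by move=> il; rewrite ltnS; apply: (@leq_bigmax_seq _ _ _ id).
(* The indices used by [u] come first, followed by the other indices below the bound [B]. *)
pose t := l ++ [seq i <- iota 0 B | i \notin l].
have tp : perm_eq t (iota 0 B).
  apply: uniq_perm; rewrite ?iota_uniq //.
    rewrite cat_uniq undup_uniq filter_uniq ?iota_uniq // andbT.
    by apply/hasPn => i; rewrite mem_filter => /andP[].
  move=> i; rewrite mem_cat mem_filter mem_iota /= add0n.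
  by case: (boolP (i \in l)) => //= /lB ->.
(* [list_perm t] sends the first [size l] indices onto [l], so its inverse [s] brings the variables
   of [u] below [N]. *)
have [s tK sK] := list_perm_bij tp.
have sb : bijective s by exists (list_perm t).
have sl i : i \in l -> (s i < N)%N.
  move=> il; suff -> : s i = index i l by apply: leq_trans lN; rewrite index_mem.
  have -> : i = list_perm t (index i l).
    by rewrite /list_perm nth_cat index_mem il nth_index.
  by rewrite tK /list_perm nth_cat index_mem il nth_index.
have : res N f (sren s u) = 0 by rewrite rf.
rewrite /= ifT.
  rewrite -(fs _ sb) renameE; last exact: bij_inj sb.
  by move/eqP; rewrite mulf_eq0 (negPf (rsgn_neq0 _ _)) (negPf fu).
apply/insuppP; split=> i /=.
  rewrite (perm_mem (perm_eq_seq_mset _)) => /mapP [j ju ->].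
  by apply: sl; rewrite mem_undup mem_cat ju.
by move=> /imfsetP [j /= ju ->]; apply: sl; rewrite mem_undup mem_cat [X in _ || X]ju orbT.
Qed.

(** Supplies the degree bound that [res_eq0] requires of the difference between [f] and its
    candidate expansion. *)
Lemma degree_spanned n m h : spanned n m h ->
  forall u, h u != 0 -> (xdeg u + tdeg u <= n + m)%N.
Proof.
elim=> [|c w k nw <- <- _ IH] u /=; first by move=> /eqP[].
have wdeg : forall v, pprod w v != 0 -> (xdeg v + tdeg v <= xweight w + tweight w)%N.
  elim: (w) => [|g w' IHw] v.
    rewrite /pprod big_nil /=; case: (v =P _) => [-> _|_]; last by rewrite eqxx.
    by rewrite /xdeg /tdeg enum_mset0 cardfs0.
  rewrite pprod_cons xweight_cons tweight_cons addnACA.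
  by apply: degM; [exact: degree_psum | exact: IHw].
by have [->|/wdeg //] := eqVneq (pprod w u) 0; rewrite mulr0 add0r => /IH.
Qed.

Lemma homogeneous_spanned n m f : homogeneous n m f -> spanned n m f.
Proof.
(* Both [f] and [h] have degree at most [n + m], so this many variables suffice to tell them
   apart. *)
move=> fh; have [h hs rfh] := res_superSym_spanned (n + m) fh.
suff /eqP : f - h = 0 by rewrite subr_eq0 => /eqP ->.
apply: (@res_eq0 (n + m)).
  move=> u /=; have [->|/(degree_spanned hs) //] := eqVneq (h u) 0.
  by rewrite subr0 => /fh [-> ->].
by rewrite [LHS](linearB (res (n + m)) f h) /= -rfh subrr.
Qed.

Theorem proposition4p4
    (S : {linear superSym -> superSym})
    (omega : {lrmorphism superSym -> superSym})
    (f : superSym) (n m : nat) :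
  is_antipode S ->
  (forall r : nat, (0 < r)%N ->
     omega (powersum r) = (-1) ^+ (r - 1)%N *: powersum r) ->
  (forall l : nat, omega (spowersum l) = (-1) ^+ l *: spowersum l) ->
  homogeneous n m f ->
  S f = (-1) ^+ (m + n)%N *: omega f.
Proof.
move=> SP op os /homogeneous_spanned; elim=> [|c w h nw <- <- _ IH].
  by rewrite !linear0.
rewrite !linearP /= IH antipode_pprod // (omega_pprod op os nw).
(* The two signs with exponent [tweight w + xweight w] cancel and leave [(-1) ^+ size w]. *)
congr (_ *: _ + _); rewrite scalerA; congr (_ *: _).
by rewrite [(-1) ^+ (_ + size w)]exprD signrMK.
Qed.
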